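(* Every set of EFD-sentences in the language $\{+,\neg,0\}$ is equivalent over $\mathsf{V}(\mathcal{P})$ to exactly one of the following: $\{\forall xy\,x=y\}$; $\{\forall x\,2x=x\}$; $\Sigma_S:=\{\varepsilon_p:p\in S\}$ for some set $S$ of prime numbers. Furthermore, the map $S\mapsto\Sigma_S$ is one-to-one (distinct $S$ give non-equivalent sets over $\mathsf V(\mathcal P)$), and thus the lattice of AE-subclasses of $\mathsf{V}(\mathcal{P})$, ordered by inclusion, is isomorphic with $\mathbf{2}\oplus\mathbf{2}^\omega$.
   Context: An MV-algebra is an algebra $(A,+,\neg,0)$ with $(A,+,0)$ an Abelian monoid, $\neg\neg x=x$, $x+\neg0=\neg0$, $\neg(\neg x+y)+y=\neg(\neg y+x)+x$. Write $1:=\neg0$, $x\vee y:=\neg(\neg x+y)+y$, $x\wedge y:=\neg(\neg x\vee\neg y)$, $x*y:=\neg(\neg x+\neg y)$, $ka=a+\dots+a$ ($k$ times), $a^k=a*\dots*a$ ($k$ times). An ideal is a nonempty down-set closed under $+$; the radical $\mathrm{rad}\,\mathbf A$ is the intersection of all maximal ideals. $\mathbf A$ is perfect if it is nontrivial and $A=\mathrm{rad}\,\mathbf A\cup\{\neg a:a\in\mathrm{rad}\,\mathbf A\}$. $\mathcal P$ is the class of perfect MV-algebras and $\mathsf V(\mathcal P)$ the variety it generates. For a positive integer $k$, $\mathsf t_k(z):=(kz\wedge\neg 2z^2)\vee z^k$ and $\varepsilon_k:=\forall x\exists! z\;\mathsf t_k(z)=x$. An EFD-sentence is a sentence $\forall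 x_1\dots x_n\exists! z_1\dots z_m\bigwedge_{i=1}^k s_i(\bar x,\bar z)=t_i(\bar x,\bar z)$ with terms $s_i,t_i$, $n\ge0$, $m\ge1$. Two sets of sentences are equivalent over a class if they have the same models in it. An AE-subclass of $\mathsf V(\mathcal P)$ is a class $\mathsf V(\mathcal P)\cap\mathrm{Mod}(\Sigma)$ with $\Sigma$ a set of EFD-sentences. $\mathbf 2$ is the two-element lattice, $\mathbf 2^\omega$ the lattice of subsets of a countably infinite set, $\oplus$ ordinal sum (first summand below). *)

(* Defs.v *)
From HB Require Import structures.
From mathcomp Require Import all_boot all_order.
From mathcomp Require Import boolp classical_sets.

Set Implicit Arguments.
Unset Strict Implicit.
Unset Printing Implicit Defensive.

Local Open Scope classical_set_scope.

(* The signature is separated from the axioms so that the derived operations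
   (1, join, meet, product, multiples, powers, t_k) are defined once, both for
   elements of an MV-algebra and for terms. *)
HB.mixin Record hasMVOps (A : Type) := {
  mv0 : A;
  mvneg : A -> A;
  mvadd : A -> A -> A
}.

#[short(type="mvSigType")]
HB.structure Definition MVSig := {A of hasMVOps A}.

Declare Scope mv_scope.
Delimit Scope mv_scope with MV.
Notation "0" := (@mv0 _) : mv_scope.
Notation "x + y" := (mvadd x y) : mv_scope.
Local Open Scope mv_scope.

Section DerivedOperations.
Variable A : mvSigType.
Implicit Types x y z : A.

Definition mv1 : A := mvneg 0.
Definition mvjoin x y : A := mvneg (mvneg x + y) + y.
Definition mvmeet x y : A := mvneg (mvjoin (mvneg x) (mvneg y)).
Definition mvmul x y : A := mvneg (mvneg x + mvneg y).

(* [iterop k op x e] is x op (... op x) with k occurrences of x, and e if k = 0 *)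
Definition mvmuln (k : nat) x : A := iterop k (@mvadd A) x 0.
Definition mvexp x (k : nat) : A := iterop k mvmul x mv1.

Definition mvt (k : nat) z : A :=
  mvjoin (mvmeet (mvmuln k z) (mvneg (mvmuln 2 (mvexp z 2)))) (mvexp z k).

End DerivedOperations.

HB.mixin Record isMVAlgebra A of hasMVOps A := {
  mvaddA : forall x y z : A, x + (y + z) = (x + y) + z;
  mvaddC : forall x y : A, x + y = y + x;
  mvadd0 : forall x : A, x + 0 = x;
  mvnegK : forall x : A, mvneg (mvneg x) = x;
  mvadd_neg0 : forall x : A, x + mvneg 0 = mvneg 0;
  mv_lukasiewicz : forall x y : A,
    mvneg (mvneg x + y) + y = mvneg (mvneg y + x) + x
}.

#[short(type="mvType")]
HB.structure Definition MVAlgebra := {A of hasMVOps A & isMVAlgebra A}.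

Section Ideals.
Variable A : mvType.

Definition mvle (x y : A) : Prop := mvjoin x y = y.

Definition mvideal (I : set A) : Prop :=
  [/\ I !=set0,
      forall x y, mvle x y -> I y -> I x
    & forall x y, I x -> I y -> I (x + y)].

Definition maximal_ideal (I : set A) : Prop :=
  [/\ mvideal I, I <> setT
    & forall J : set A, mvideal J -> J <> setT -> I `<=` J -> J = I].

Definition radical : set A := [set a | forall I, maximal_ideal I -> I a].

End Ideals.

Arguments radical A : clear implicits.

(* [mvType -> Prop] rather than [set mvType], which would force the universe of
   carriers to be strictly below the one of [set]. *)
Definition mvclass := mvType -> Prop.

Definition perfect : mvclass := fun A =>
  (exists x y : A, x <> y) /\
  [set: A] = radical A `|` [set mvneg a | a in radical A].

Definition mvmorphism (A B : mvType) (f : A -> B) : Prop :=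
  [/\ f 0 = 0, forall x, f (mvneg x) = mvneg (f x)
    & forall x y, f (x + y) = f x + f y].

Definition mvprod (I : Type) (F : I -> mvType) := forall i, F i.

Section Product.
Variables (I : Type) (F : I -> mvType).
Implicit Types x y z : mvprod F.

HB.instance Definition _ := @hasMVOps.Build (mvprod F)
  (fun i => 0) (fun x i => mvneg (x i)) (fun x y i => x i + y i).

Let prodA x y z : x + (y + z) = (x + y) + z.
Proof. by apply: functional_extensionality_dep => i; apply: mvaddA. Qed.
Let prodC x y : x + y = y + x.
Proof. by apply: functional_extensionality_dep => i; apply: mvaddC. Qed.
Let prod0 x : x + 0 = x.
Proof. by apply: functional_extensionality_dep => i; apply: mvadd0. Qed.
Let prodK x : mvneg (mvneg x) = x.
Proof. by apply: functional_extensionality_dep => i; apply: mvnegK. Qed.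
Let prod_neg0 x : x + mvneg 0 = mvneg 0.
Proof. by apply: functional_extensionality_dep => i; apply: mvadd_neg0. Qed.
Let prodL x y : mvneg (mvneg x + y) + y = mvneg (mvneg y + x) + x.
Proof. by apply: functional_extensionality_dep => i; apply: mv_lukasiewicz. Qed.

HB.instance Definition _ := @isMVAlgebra.Build (mvprod F)
  prodA prodC prod0 prodK prod_neg0 prodL.

End Product.

(* Subalgebras are taken up to isomorphism, as injective morphisms. *)
Definition variety (W : mvclass) : Prop :=
  [/\ forall (A B : mvType) (f : A -> B),
        mvmorphism f -> (forall b, exists a, f a = b) -> W A -> W B,
      forall (A B : mvType) (f : A -> B),
        mvmorphism f -> injective f -> W B -> W A
    & forall (I : Type) (F : I -> mvType),
        (forall i, W (F i)) -> W (mvprod F)].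

Definition generated_variety (K : mvclass) : mvclass := fun A =>
  forall W : mvclass, variety W -> (forall B, K B -> W B) -> W A.

Inductive term (V : Type) : Type :=
| Var of V
| Zero
| Neg of term V
| Add of term V & term V.
Arguments Zero {V}.

HB.instance Definition _ (V : Type) :=
  @hasMVOps.Build (term V) Zero (@Neg V) (@Add V).

Fixpoint eval (A : mvSigType) (V : Type) (v : V -> A) (t : term V) : A :=
  match t with
  | Var i => v i
  | Zero => 0
  | Neg t1 => mvneg (eval v t1)
  | Add t1 t2 => eval v t1 + eval v t2
  end.

(* The two kinds of sentences needed: universally quantified identities, and
   EFD-sentences, with n variables x = [inl _] and m.+1 >= 1 variables
   z = [inr _]. *)
Variant sentence : Type :=
| Identity (n : nat) (s t : term 'I_n)
| EFD (n m : nat)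
    (eqs : seq (term ('I_n + 'I_m.+1) * term ('I_n + 'I_m.+1))).

Definition efd_sentence (phi : sentence) : Prop :=
  exists n m eqs, phi = @EFD n m eqs.

Definition assign (A : Type) n m (x : n.-tuple A) (z : m.-tuple A)
    (v : 'I_n + 'I_m) : A :=
  match v with inl i => tnth x i | inr j => tnth z j end.

Definition sat (A : mvType) (phi : sentence) : Prop :=
  match phi with
  | Identity n s t =>
      forall x : n.-tuple A, eval (tnth x) s = eval (tnth x) t
  | EFD n m eqs =>
      forall x : n.-tuple A, exists! z : m.+1.-tuple A,
        forall i, (i < size eqs)%N ->
          let e := nth (Zero, Zero) eqs i in
          eval (assign x z) e.1 = eval (assign x z) e.2
  end.

Definition model (Sigma : set sentence) : mvclass := fun A =>
  forall phi, Sigma phi -> sat A phi.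

Definition equivalent_over (K : mvclass) (Sigma Sigma' : set sentence) : Prop :=
  forall A, K A -> (model Sigma A <-> model Sigma' A).

Definition VP : mvclass := generated_variety perfect.

Definition trivial_axiom : sentence :=
  @Identity 2 (Var ord0) (Var ord_max).

Definition boolean_axiom : sentence :=
  @Identity 1 (mvmuln 2 (Var ord0 : term _)) (Var ord0).

Definition efd_eps (k : nat) : sentence :=
  @EFD 1 0 [:: (mvt k (Var (inr ord0) : term _), Var (inl ord0))].

Definition Sigma_of (S : set nat) : set sentence := [set efd_eps p | p in S].

Definition AE_subclass (C : mvclass) : Prop :=
  exists2 Sigma : set sentence, Sigma `<=` efd_sentence &
    C = (fun A => VP A /\ model Sigma A).

Definition AE_class := {C : mvclass | AE_subclass C}.

Definition AE_le (C D : AE_class) : Prop :=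
  forall A, proj1_sig C A -> proj1_sig D A.

Definition ordsum_le (P Q : Type) (leP : P -> P -> Prop) (leQ : Q -> Q -> Prop)
    (x y : P + Q) : Prop :=
  match x, y with
  | inl a, inl b => leP a b
  | inl _, inr _ => True
  | inr _, inl _ => False
  | inr a, inr b => leQ a b
  end.

(* A bijection preserving and reflecting the order is an isomorphism for the
   lattice structures that the orders determine. *)
Definition order_isomorphic (P Q : Type) (leP : P -> P -> Prop)
    (leQ : Q -> Q -> Prop) : Prop :=
  exists2 f : P -> Q, bijective f & forall x y, leP x y <-> leQ (f x) (f y).

Definition two_le (a b : bool) : Prop := (a <= b)%O.

Definition exactly_one_of_three (P Q R : Prop) : Prop :=
  [/\ P \/ Q \/ R, ~ (P /\ Q), ~ (P /\ R) & ~ (Q /\ R)].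

(* Main.v *)
From HB Require Import structures.
Require Import Defs.
From mathcomp Require Import all_boot all_order all_algebra.
From mathcomp Require Import boolp classical_sets cardinality.

(* Nontrivial chains in V(P) are the algebras Gamma(Z lex G) of ordered abelian
   groups G, with elements (0, r) and (1, -r) for r >= 0, and t_k multiplies r by
   k; so eps_k says that the radical is k-divisible.  On such chains, terms are
   piecewise linear with integer coefficients.

   Fix an EFD-sentence phi with a non-Boolean model A0 in V(P).  Since A0 contains
   Gamma(Z lex Z), every quasi-identity of A0 holds throughout V(P), by
   Fourier-Motzkin elimination; hence solutions are unique in all of V(P).  The
   same elimination shows that phi is solvable on every chain up to multiplication
   by some N >= 1.  A prime p dividing N can be cancelled if G is p-divisible, and
   also if phi has some model A that is not p-divisible: otherwise an integer
   approximation of the solution would be carried into A along an element of the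
   radical not divisible by p, and uniqueness in A would make it divisible.
   Solvability passes from chains to all of V(P) by taking a congruence maximal
   among those modulo which there is no solution: permutability of congruences and
   uniqueness in quotients show that the quotient is a chain.  So phi is equivalent
   to the eps_p for the primes p such that all models of phi are p-divisible.

   Distinct sets of primes are separated by the localizations of Z. *)

Set Implicit Arguments.
Unset Strict Implicit.
Unset Printing Implicit Defensive.

Local Open Scope classical_set_scope.

(** * MV-algebra arithmetic and congruences *)

(** Two devices replace the passage to divisible hulls. Quantifiers are eliminated only up to a
    common positive multiple of the parameters, which costs nothing because sign conditions on
    integer linear forms are homogeneous. And multiplication of magnitudes by k is itself the term
    function t_k, an injective endomorphism of every algebra of the variety; so a factor can be
    cancelled from a solution as soon as it divides all magnitudes of the unknowns. The obstacle is
    that divisibility is invisible to sign conditions. The integer approximation must therefore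
    preserve the signs, zeros included, of all forms that the system tests, and at the same time the
    indivisibility by p of one unknown. Elimination of all variables yields a point with the right
    signs, the Smith normal form a point with the right residue, and a large multiple of p times the
    first plus the second has both properties. Bits range over a finite set, unlike magnitudes: the
    arguments on chains fix the bits and quantify over magnitudes only. *)

Section Arithmetic.
Local Open Scope mv_scope.
Variable A : mvType.
Implicit Types x y z u v w : A.

Definition mvsub x y : A := mvneg (mvneg x + y).
(** The natural order as one equation without joins: homomorphisms preserve it at once and
    residuation ([mle_subl]) becomes associativity. [mvleP] identifies it with [mvle]. *)
Definition mle x y : Prop := mvneg x + y = mv1 A.

Lemma mv0add x : 0 + x = x. Proof. by rewrite mvaddC mvadd0. Qed.
Lemma mvadd1 x : x + mv1 A = mv1 A. Proof. exact: mvadd_neg0. Qed.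
Lemma mv1add x : mv1 A + x = mv1 A. Proof. by rewrite mvaddC mvadd1. Qed.
Lemma mvneg1 : mvneg (mv1 A) = 0. Proof. exact: mvnegK. Qed.
Lemma mvaddCA x y z : x + (y + z) = y + (x + z).
Proof. by rewrite !mvaddA (mvaddC x). Qed.
Lemma mvaddACA x y z t : (x + y) + (z + t) = (x + z) + (y + t).
Proof. by rewrite -!mvaddA (mvaddCA y). Qed.

Lemma mv_trivial : 0 = mv1 A -> forall x y, x = y.
Proof. by move=> e x y; rewrite -[x]mvadd0 -[y]mvadd0 e !mvadd1. Qed.

Lemma mvnegx_add x : mvneg x + x = mv1 A.
Proof.
by have := mv_lukasiewicz x (mv1 A); rewrite !mvadd1 mvneg1 mv0add.
Qed.
Lemma mvadd_negx x : x + mvneg x = mv1 A.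
Proof. by rewrite mvaddC mvnegx_add. Qed.

Lemma mvneg_inj x y : mvneg x = mvneg y -> x = y.
Proof. by move=> /(congr1 (@mvneg A)); rewrite !mvnegK. Qed.

Lemma mle_refl x : mle x x. Proof. exact: mvnegx_add. Qed.
Lemma mle_subK x y : mle x y -> mvsub y x + x = y.
Proof. by rewrite /mle /mvsub => h; rewrite mv_lukasiewicz h mvneg1 mv0add. Qed.
Lemma mle_addr x y : mle x (x + y).
Proof. by rewrite /mle mvaddA mvnegx_add mv1add. Qed.
Lemma mle_addl x y : mle x (y + x).
Proof. by rewrite mvaddC; apply: mle_addr. Qed.
Lemma mle_trans y x z : mle x y -> mle y z -> mle x z.
Proof.
move=> /mle_subK <- /mle_subK <-; rewrite (mvaddC _ (_ + x)) (mvaddC _ x) -mvaddA.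
exact: mle_addr.
Qed.
Lemma mle_anti x y : mle x y -> mle y x -> x = y.
Proof. by move=> /mle_subK {2}<-; rewrite /mvsub => ->; rewrite mvneg1 mv0add. Qed.
Lemma mle0 x : mle 0 x. Proof. exact: mv1add. Qed.
Lemma mle1 x : mle x (mv1 A). Proof. exact: mvadd1. Qed.
Lemma mle_x0 x : mle x 0 -> x = 0. Proof. by move=> h; apply: mle_anti (mle0 _). Qed.
Lemma mle_add2 x y z t : mle x y -> mle z t -> mle (x + z) (y + t).
Proof.
by move=> /mle_subK <- /mle_subK <-; rewrite mvaddACA; apply: mle_addl.
Qed.
Lemma mle_neg x y : mle x y -> mle (mvneg y) (mvneg x).
Proof. by rewrite /mle mvnegK mvaddC. Qed.

Lemma mle_subl x y z : mle (mvsub x y) z <-> mle x (z + y).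
Proof. by rewrite /mle /mvsub mvnegK -mvaddA (mvaddC y). Qed.
Lemma sub_le x y : mle (mvsub x y) x.
Proof. by apply/mle_subl; apply: mle_addr. Qed.
Lemma mvsubxx x : mvsub x x = 0.
Proof. by rewrite /mvsub mvnegx_add mvneg1. Qed.
Lemma sub_eq0 x y : mvsub x y = 0 <-> mle x y.
Proof.
split=> [h|h]; last by rewrite /mvsub h mvneg1.
by apply: mvneg_inj; rewrite mvneg1.
Qed.
Lemma mle_sub x y z : mle x y -> mle (mvsub x z) (mvsub y z).
Proof.
by move=> h; apply/mle_subl; apply: mle_trans h _; apply/mle_subl; exact: mle_refl.
Qed.

Lemma joinE x y : mvjoin x y = mvsub x y + y. Proof. by []. Qed.
Lemma joinC x y : mvjoin x y = mvjoin y x. Proof. exact: mv_lukasiewicz. Qed.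
Lemma mle_joinr x y : mle y (mvjoin x y). Proof. exact: mle_addl. Qed.
Lemma mle_joinl x y : mle x (mvjoin x y). Proof. by rewrite joinC; exact: mle_joinr. Qed.
Lemma join_le x y z : mle x z -> mle y z -> mle (mvjoin x y) z.
Proof.
move=> xz yz; rewrite -(mle_subK yz) joinE; apply: mle_add2 (mle_refl _).
exact: mle_sub.
Qed.
Lemma join_idPr x y : mle x y -> mvjoin x y = y.
Proof.
by move=> h; apply: mle_anti (mle_joinr _ _); apply: join_le h (mle_refl _).
Qed.
Lemma meet_lel x y : mle (mvmeet x y) x.
Proof. by rewrite -{2}[x]mvnegK; apply: mle_neg; apply: mle_joinl. Qed.
Lemma meet_ler x y : mle (mvmeet x y) y.
Proof. by rewrite -{2}[y]mvnegK; apply: mle_neg; apply: mle_joinr. Qed.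
Lemma mle_meet x y z : mle z x -> mle z y -> mle z (mvmeet x y).
Proof.
move=> zx zy; rewrite -[z]mvnegK; apply: mle_neg.
by apply: join_le; apply: mle_neg.
Qed.
Lemma meet_idPl x y : mle x y -> mvmeet x y = x.
Proof.
by move=> h; apply: mle_anti (meet_lel _ _) _; apply: mle_meet (mle_refl _) h.
Qed.
Lemma meet_idPr x y : mle y x -> mvmeet x y = y.
Proof.
by move=> h; apply: mle_anti (meet_ler _ _) _; apply: mle_meet h (mle_refl _).
Qed.

Lemma sub_sub x y : mvsub x (mvsub x y) = mvmeet x y.
Proof.
by rewrite /mvmeet joinC /mvjoin /mvsub mvnegK (mvaddC y) (mvaddC (mvneg x) (mvneg _)).
Qed.
Lemma addK x y : mvsub (x + y) y = mvmeet x (mvneg y).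
Proof.
by rewrite /mvmeet /mvsub /mvjoin !mvnegK.
Qed.
Lemma sub_meet x y : x = mvsub x y + mvmeet x y.
Proof. by rewrite -sub_sub mvaddC (mle_subK (sub_le x y)). Qed.
Lemma add_cancel x y z : mle y (mvneg x) -> mle z (mvneg x) -> x + y = x + z -> y = z.
Proof.
move=> hy hz /(congr1 (fun t => mvsub t x)).
by rewrite ![x + _]mvaddC !addK !meet_idPl.
Qed.

(** With m the meet of x and y, x = (x - y) + m and y = (y - x) + m. So m + w lies below both x and
    y, hence equals m, and w cancels because it lies below the negation of m. *)
Lemma prelinear w x y : mle w (mvsub x y) -> mle w (mvsub y x) -> w = 0.
Proof.
move=> wx wy; set m := mvmeet x y.
have mx : x = mvsub x y + m by apply: sub_meet.
have my : y = mvsub y x + m by rewrite /m /mvmeet joinC; apply: sub_meet.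
have mw : m + w = m.
  apply: mle_anti (mle_addr _ _); apply: mle_meet.
    by rewrite [X in mle _ X]mx mvaddC; apply: mle_add2 => //; apply: mle_refl.
  by rewrite [X in mle _ X]my mvaddC; apply: mle_add2 => //; apply: mle_refl.
have wm : mle w (mvneg m).
  apply: mle_trans wx _; apply: mle_neg; rewrite /m.
  by apply: mle_trans (meet_ler _ _) _; apply: mle_addl.
apply: (@add_cancel m) => //; first exact: mle0.
by rewrite mw mvadd0.
Qed.

Fixpoint nmul n x : A := if n is n'.+1 then x + nmul n' x else 0.

Lemma nmulS n x : nmul n.+1 x = x + nmul n x. Proof. by []. Qed.
Lemma nmulE n x : mvmuln n x = nmul n x.
Proof.
case: n => // n; rewrite /mvmuln iteropS.
by elim: n => [|n IH]; rewrite /= ?mvadd0 // IH.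
Qed.
Lemma nmulD n m x : nmul (n + m) x = nmul n x + nmul m x.
Proof. by elim: n => [|n IH] /=; rewrite ?mv0add // IH mvaddA. Qed.
Lemma mle_nmul n m x : (n <= m)%N -> mle (nmul n x) (nmul m x).
Proof. by move=> /subnK <-; rewrite nmulD; apply: mle_addl. Qed.

Definition disj u v := forall w, mle w u -> mle w v -> w = 0.

Lemma disjC u v : disj u v -> disj v u. Proof. by move=> h w *; apply: h. Qed.
(** Split w as (w - u) plus its meet with u; the meet vanishes by disjointness, so w = w - u lies
    below one multiple of u less. *)
Lemma disj_mul n u v : disj u v -> disj (nmul n u) v.
Proof.
move=> d; elim: n => [|n IH] w /= wu wv; first exact: mle_x0.
suff e : w = mvsub w u.
  by apply: IH => //; rewrite e; apply/mle_subl; rewrite mvaddC.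
rewrite {1}(sub_meet w u) (d (mvmeet w u)) ?mvadd0 //; first exact: meet_ler.
exact: mle_trans (meet_lel _ _) wv.
Qed.

End Arithmetic.

Section Congruences.
Local Open Scope mv_scope.
Variable A : mvType.
Implicit Types (x y z u v w : A) (R : A -> A -> Prop).

Definition congruence R :=
  [/\ forall x, R x x, forall x y, R x y -> R y x,
      forall x y z, R x y -> R y z -> R x z,
      forall x y, R x y -> R (mvneg x) (mvneg y)
    & forall x y x' y', R x y -> R x' y' -> R (x + x') (y + y')].

(** The congruence of the ideal generated by [u]. *)
Definition theta u x y :=
  exists n, mle x (y + nmul n u) /\ mle y (x + nmul n u).

Lemma theta_congr u : congruence (theta u).
Proof.
split.
- by move=> x; exists 0%N; split; apply: mle_addr.
- by move=> x y [n [a b]]; exists n.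
- move=> x y z [n [a b]] [m [c d]]; exists (n + m)%N; rewrite nmulD; split.
    apply: mle_trans a _; rewrite [_ + nmul m u]mvaddC mvaddA.
    exact: mle_add2 c (mle_refl _).
  by apply: mle_trans d _; rewrite mvaddA; exact: mle_add2 b (mle_refl _).
- move=> x y [n [a b]]; exists n; move: a b; rewrite /mle !mvnegK => a b.
  by split; rewrite mvaddCA.
- move=> x y x' y' [n [a b]] [m [c d]]; exists (n + m)%N; rewrite nmulD.
  by rewrite !(mvaddACA _ _ (nmul n u)); split; apply: mle_add2.
Qed.

Lemma theta_gen u : theta u u 0.
Proof.
exists 1%N => /=; rewrite mvadd0 mv0add; split; [exact: mle_refl|exact: mle0].
Qed.

Lemma theta_disj x y u v : disj u v -> theta u x y -> theta v x y -> x = y.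
Proof.
move=> d [n [a b]] [m [c e]].
have dd : disj (nmul n u) (nmul m v) by apply/disj_mul/disjC/disj_mul/disjC.
by apply: mle_anti; apply/sub_eq0; apply: dd; apply/mle_subl; rewrite mvaddC.
Qed.

(** A Mal'cev term; the next two lemmas are its defining identities, and they make congruences
    permute. *)
Definition malcev x y z := mvmeet (mvsub x y + z) (mvsub z y + x).

Lemma malcevl x y : malcev x y y = x.
Proof.
rewrite /malcev -joinE mvsubxx mv0add meet_idPr //; exact: mle_joinl.
Qed.
Lemma malcevr x z : malcev x x z = z.
Proof.
rewrite /malcev -joinE mvsubxx mv0add meet_idPl //; exact: mle_joinl.
Qed.

Lemma congr_sub R x y x' y' :
  congruence R -> R x x' -> R y y' -> R (mvsub x y) (mvsub x' y').
Proof. by case=> r s t n a h k; apply: (n); apply: (a) => //; apply: n. Qed.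
Lemma congr_meet R x y x' y' :
  congruence R -> R x x' -> R y y' -> R (mvmeet x y) (mvmeet x' y').
Proof.
case=> r s t n a h k; have kn := n _ _ k; apply: (n); apply: (a) (kn); apply: (n).
by apply: (a) (kn); apply: (n); apply: (n).
Qed.
Lemma congr_malcev R x y z x' y' z' : congruence R ->
  R x x' -> R y y' -> R z z' -> R (malcev x y z) (malcev x' y' z').
Proof.
move=> c h k l; case: (c) => r s t n a.
by apply: congr_meet => //; apply: a => //; apply: congr_sub.
Qed.

Definition comp_rel R R' x y := exists2 z, R x z & R' z y.

Lemma comp_rel_swap R R' x y : congruence R -> congruence R' ->
  comp_rel R' R x y -> comp_rel R R' x y.
Proof.
move=> c c' [z h k]; case: (c) (c') => r s t n a [r' s' t' n' a'].
(* Replacing y by z modulo [R] turns this element into x; replacing z by x modulo [R'] turns it into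
   y. *)
exists (malcev x z y).
  by rewrite -{1}(malcevl x y); apply: congr_malcev => //; apply: s.
by rewrite -{2}(malcevr x y); apply: congr_malcev => //; apply: s'.
Qed.

Lemma comp_rel_congr R R' : congruence R -> congruence R' -> congruence (comp_rel R R').
Proof.
move=> c c'; have sw x y := @comp_rel_swap R R' x y c c'.
case: (c) (c') => r s t n a [r' s' t' n' a']; split.
- by move=> x; exists x.
- by move=> x y [z h k]; apply: sw; exists z; [apply: s'|apply: s].
- move=> x y z [u h k] [v l m].
  have [w p q] : comp_rel R R' u v by apply: sw; exists y.
  by exists w; [apply: t p|apply: t' m].
- by move=> x y [z h k]; exists (mvneg z); [apply: n|apply: n'].
- move=> x y x' y' [z h k] [z' h' k'].
  by exists (z + z'); [apply: a|apply: a'].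
Qed.

End Congruences.

(** * Quotients and maximal congruences *)

Section Homomorphisms.
Local Open Scope mv_scope.

Section Basic.
Variables (A B : mvType) (f : A -> B) (hf : mvmorphism f).

Lemma hom0 : f 0 = 0. Proof. by case: hf. Qed.
Lemma homN x : f (mvneg x) = mvneg (f x). Proof. by case: hf. Qed.
Lemma homD x y : f (x + y) = f x + f y. Proof. by case: hf. Qed.
Lemma hom1 : f (mv1 A) = mv1 B. Proof. by rewrite homN hom0. Qed.
Lemma hom_sub x y : f (mvsub x y) = mvsub (f x) (f y).
Proof. by rewrite !(homN, homD). Qed.
Lemma hom_mul x y : f (mvmul x y) = mvmul (f x) (f y).
Proof. by rewrite !(homN, homD). Qed.
Lemma hom_join x y : f (mvjoin x y) = mvjoin (f x) (f y).
Proof. by rewrite !(homN, homD). Qed.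
Lemma hom_meet x y : f (mvmeet x y) = mvmeet (f x) (f y).
Proof. by rewrite homN hom_join !homN. Qed.
Lemma hom_nmul n x : f (nmul n x) = nmul n (f x).
Proof. by elim: n => [|n IH] /=; rewrite ?hom0 // homD IH. Qed.
Lemma hom_muln n x : f (mvmuln n x) = mvmuln n (f x).
Proof. by rewrite !nmulE hom_nmul. Qed.
Lemma hom_exp n x : f (mvexp x n) = mvexp (f x) n.
Proof.
case: n => [|n]; first exact: hom1.
by rewrite /mvexp !iteropS; elim: n => //= n <-; rewrite hom_mul.
Qed.
Lemma hom_t n x : f (mvt n x) = mvt n (f x).
Proof. by rewrite hom_join hom_meet homN !(hom_muln, hom_exp). Qed.
Lemma hom_eval V (v : V -> A) t : f (eval v t) = eval (f \o v) t.
Proof.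
by elim: t => [i||t IH|t IH u IHu] //=; rewrite ?hom0 ?homN ?homD ?IH ?IHu.
Qed.
Lemma hom_mle x y : mle x y -> mle (f x) (f y).
Proof. by rewrite /mle -homN -homD => ->; apply: hom1. Qed.

End Basic.

Lemma hom_comp (A B C : mvType) (f : A -> B) (g : B -> C) :
  mvmorphism f -> mvmorphism g -> mvmorphism (g \o f).
Proof. by move=> hf hg; split=> * /=; rewrite ?hom0 ?homN ?homD. Qed.

End Homomorphisms.

Section EquivalenceClasses.
Variables (T : Type) (R : T -> T -> Prop).

Definition classes := {X : set T | exists x, X = R x}.
Definition class_of x : classes := exist _ (R x) (ex_intro _ x erefl).
Definition class_repr (q : classes) : T := sval (cid (svalP q)).

Lemma class_reprK q : class_of (class_repr q) = q.
Proof.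
have := svalP (cid (svalP q)); rewrite -/(class_repr q); move: (class_repr q) => x.
by move: q => [X hX] /= e; apply: eq_exist.
Qed.

Lemma class_ofP : (forall x, R x x) -> (forall x y, R x y -> R y x) ->
  (forall x y z, R x y -> R y z -> R x z) ->
  forall x y, class_of x = class_of y <-> R x y.
Proof.
move=> r s t x y; split=> [/(congr1 sval) /= ->//|xy].
apply: eq_exist; apply/funext => z; apply/propext; split=> h.
  exact: t (s _ _ xy) h.
exact: t xy h.
Qed.
End EquivalenceClasses.

Section Quotient.
Local Open Scope mv_scope.
Variables (A : mvType) (R : A -> A -> Prop) (congrR : congruence R).

(* The proof argument makes the MV-algebra structure inferable from the type. *)
Definition quot of congruence R := classes R.
Local Notation quotR := (quot congrR).
Definition cls x : quotR := class_of R x.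
Definition rep (q : quotR) : A := class_repr q.

Lemma repK q : cls (rep q) = q. Proof. exact: class_reprK. Qed.
Lemma clsP x y : cls x = cls y <-> R x y.
Proof. by have [r s t _ _] := congrR; apply: class_ofP. Qed.
Lemma rep_cls x : R (rep (cls x)) x. Proof. by apply/clsP; rewrite repK. Qed.

HB.instance Definition _ := @hasMVOps.Build quotR (cls 0)
  (fun q => cls (mvneg (rep q))) (fun q q' => cls (rep q + rep q')).

Lemma clsN x : mvneg (cls x) = cls (mvneg x).
Proof. by apply/clsP; have [_ _ _ n _] := congrR; apply: n; apply: rep_cls. Qed.
Lemma clsD x y : cls x + cls y = cls (x + y).
Proof. by apply/clsP; have [_ _ _ _ a] := congrR; apply: a; apply: rep_cls. Qed.
Lemma cls_ind (P : quotR -> Prop) : (forall x, P (cls x)) -> forall q, P q.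
Proof. by move=> h q; rewrite -(repK q). Qed.

Let quotA (x y z : quotR) : x + (y + z) = (x + y) + z.
Proof.
by elim/cls_ind: x => x; elim/cls_ind: y => y; elim/cls_ind: z => z;
  rewrite !clsD mvaddA.
Qed.
Let quotC (x y : quotR) : x + y = y + x.
Proof. by elim/cls_ind: x => x; elim/cls_ind: y => y; rewrite !clsD mvaddC. Qed.
Let quot0 (x : quotR) : x + 0 = x.
Proof. by elim/cls_ind: x => x; rewrite clsD mvadd0. Qed.
Let quotK (x : quotR) : mvneg (mvneg x) = x.
Proof. by elim/cls_ind: x => x; rewrite !clsN mvnegK. Qed.
Let quot_neg0 (x : quotR) : x + mvneg 0 = mvneg 0.
Proof. by elim/cls_ind: x => x; rewrite clsN clsD mvadd_neg0. Qed.
Let quotL (x y : quotR) : mvneg (mvneg x + y) + y = mvneg (mvneg y + x) + x.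
Proof.
elim/cls_ind: x => x; elim/cls_ind: y => y.
by rewrite !(clsN, clsD) mv_lukasiewicz.
Qed.

HB.instance Definition _ := @isMVAlgebra.Build quotR
  quotA quotC quot0 quotK quot_neg0 quotL.

Lemma cls_hom : @mvmorphism A quotR cls.
Proof. by split=> [|x|x y]; rewrite ?clsN ?clsD. Qed.
Lemma cls_surj (q : quotR) : exists x, cls x = q.
Proof. by exists (rep q); apply: repK. Qed.

End Quotient.

(** * Congruences maximal among those without solutions *)

Section MaximalCongruence.
Local Open Scope mv_scope.
Variables (A : mvType) (Z : Type) (k : nat) (L : Z -> nat -> A * A).
Implicit Types R S : A -> A -> Prop.

(** [L z i] stands for the two sides of the i-th equation at the candidate [z]. That there are
    finitely many equations is what makes Zorn's lemma applicable. *)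
Definition solved_mod R z := forall i, (i < k)%N -> R (L z i).1 (L z i).2.
Definition solvable_mod R := exists z, solved_mod R z.

Definition union_rel (F : set (A -> A -> Prop)) x y := exists2 R, F R & R x y.

Lemma union_rel2 F :
  (forall R S, F R -> F S -> (forall x y, R x y -> S x y) \/
    (forall x y, S x y -> R x y)) ->
  forall x y x' y', union_rel F x y -> union_rel F x' y' ->
  exists R, [/\ F R, R x y & R x' y'].
Proof.
move=> tot x y x' y' [R FR h] [S FS l].
by case: (tot R S FR FS) => RS; [exists S|exists R]; split=> //; apply: RS.
Qed.

Lemma union_congr F R0 : F R0 -> (forall R, F R -> congruence R) ->
  (forall R S, F R -> F S -> (forall x y, R x y -> S x y) \/
    (forall x y, S x y -> R x y)) ->
  congruence (union_rel F).
Proof.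
move=> FR0 cF tot; have u2 := union_rel2 tot; split.
- by move=> x; exists R0 => //; case: (cF _ FR0).
- by move=> x y [R FR h]; exists R => //; case: (cF _ FR) => _ s *; apply: s.
- move=> x y z h l; have [R [FR h' l']] := u2 _ _ _ _ h l.
  by exists R => //; case: (cF _ FR) => _ _ t *; apply: t h' l'.
- by move=> x y [R FR h]; exists R => //; case: (cF _ FR) => _ _ _ n *; apply: n.
- move=> x y x' y' h l; have [R [FR h' l']] := u2 _ _ _ _ h l.
  by exists R => //; case: (cF _ FR) => _ _ _ _ a; apply: a.
Qed.

Lemma eq_congr : congruence (@eq A).
Proof. by split=> // [x y z -> ->|x y ->|x y x' y' -> ->]. Qed.

Lemma maximal_unsolvable : ~ solvable_mod eq ->
  exists R, [/\ congruence R, ~ solvable_mod R &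
    forall S, congruence S -> (forall x y, R x y -> S x y) ->
      ~ (forall x y, S x y -> R x y) -> solvable_mod S].
Proof.
move=> uns; pose T := {R | congruence R /\ ~ solvable_mod R}.
pose sub (R S : T) := `[< forall x y, sval R x y -> sval S x y >].
have [|||chains|R maxR] := @Zorn T sub.
- by move=> R; apply/asboolP.
- by move=> R S U /asboolP RS /asboolP SU; apply/asboolP=> x y /RS /SU.
- move=> [R hR] [S hS] /asboolP /= RS /asboolP /= SR; apply: eq_exist.
  by apply/funext => x; apply/funext => y; apply/propext; split; [apply: RS|apply: SR].
- move=> chainP; have [[R0 FR0]|noF] := pselect (exists R : T, chains R); last first.
    exists (exist _ eq (conj eq_congr uns)) => R FR.
    by case: noF; exists R.
  pose F := [set sval R | R in chains].
  have FF0 : F (sval R0) by exists R0.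
  have tot R S : F R -> F S -> (forall x y, R x y -> S x y) \/
      (forall x y, S x y -> R x y).
    move=> [R' cR' <-] [S' cS' <-].
    by by case: (chainP _ _ cR' cS') => /asboolP; [left|right].
  have cU : congruence (union_rel F).
    by apply: union_congr FF0 _ tot => R [[R' [cR' ?]] _ <-].
  (* A solution modulo the union uses k related pairs; by induction on k, one member of the chain
     relates them all. *)
  have nU : ~ solvable_mod (union_rel F).
    move=> [z hz]; suff [R FR] : exists2 R, F R & solved_mod R z.
      by move: FR => [[R' [? nR']] _ /= <-] h; apply: nR'; exists z.
    rewrite /solved_mod in hz *; elim: k hz => [|n IH] hz; first by exists (sval R0).
    have [i lin|R FR hR] := IH _; first by apply: hz; apply: leqW.
    have [S FS h] := hz n (ltnSn n).
    have [RS|SR] := tot _ _ FR FS.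
      exists S => // i; rewrite ltnS leq_eqVlt => /predU1P[->//|lin].
      by apply: RS; apply: hR.
    exists R => // i; rewrite ltnS leq_eqVlt => /predU1P[->|lin].
      exact: SR.
    exact: hR.
  exists (exist _ (union_rel F) (conj cU nU)) => R FR; apply/asboolP => x y h /=.
  by exists (sval R) => //; exists R.
exists (sval R); have [cR nR] := svalP R; split=> // S cS RS nSR.
apply: contrapT => nS; have := maxR (exist _ S (conj cS nS)).
by move=> /(_ (asboolT RS)) /(congr1 sval) /= e; apply: nSR => x y; rewrite e.
Qed.

(* Two solvable congruences above a maximal unsolvable [R] cannot have
   intersection [R]; applied to the congruences generated by the disjoint
   elements [x - y] and [y - x] of the quotient, this makes the quotient a chain. *)
Lemma unsolvable_chain : ~ solvable_mod eq ->
  (forall R S, congruence R -> congruence S -> solvable_mod R ->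
     solvable_mod S -> solvable_mod (fun x y => R x y /\ S x y)) ->
  exists R (cR : congruence R), ~ solvable_mod R /\
    forall q q' : quot cR, mle q q' \/ mle q' q.
Proof.
move=> uns patch; have [R [cR nR maxR]] := maximal_unsolvable uns.
exists R, cR; split=> // q q'; apply: contrapT => /not_orP[h h'].
pose pull u x y := theta u (cls cR x) (cls cR y).
have c u : congruence (pull u).
  case: (@theta_congr (quot cR) u) => r s t n a; split.
  - by move=> x; apply: r.
  - by move=> x y; apply: s.
  - by move=> x y z; apply: t.
  - by move=> x y; rewrite /pull -!(clsN cR); apply: n.
  - by move=> x y x' y'; rewrite /pull -!(clsD cR); apply: a.
have sol u : u <> 0 -> solvable_mod (pull u).
  move=> nu; apply: maxR (c u) _ _ => [x y /(clsP cR) xy|le].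
    by rewrite /pull xy; case: (@theta_congr (quot cR) u).
  apply: nu; rewrite -(repK u) -[0]repK; apply/(clsP cR)/le.
  by rewrite /pull !repK; apply: theta_gen.
have [] := patch _ _ (c (mvsub q q')) (c (mvsub q' q)).
- by apply: sol => /sub_eq0.
- by apply: sol => /sub_eq0.
move=> z hz; apply: nR; exists z => i ik; have [a b] := hz i ik.
apply/(clsP cR); apply: theta_disj a b => w; exact: prelinear.
Qed.

End MaximalCongruence.

(** * Ordered groups and their MV-algebras *)

(** The order is given by its strictly positive elements, as a boolean predicate, so that truncated
    subtraction and the evaluation of decision trees are plain conditionals. Antisymmetry follows
    from [pos0] and [posD], see [posN]. *)
Record ogroup := Ogroup {
  og_sort :> zmodType;
  pos : og_sort -> bool;
  pos0 : pos 0%R = false;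
  posD : forall x y, pos x -> pos y -> pos (x + y)%R;
  pos_total : forall x, x <> 0%R -> pos x \/ pos (- x)%R
}.
Arguments pos {_} _.

Section OrderedGroups.
Import GRing.Theory.
Local Open Scope ring_scope.
Variable G : ogroup.
Implicit Types r s t : G.

Definition ge0 r := ~~ pos (- r).

Lemma posN r : pos r -> pos (- r) = false.
Proof.
by move=> p; apply/negP => /(posD p); rewrite subrr pos0.
Qed.

Variant sign_spec r : bool -> bool -> Prop :=
| SignZero of r = 0 : sign_spec r false false
| SignPos of pos r : sign_spec r true false
| SignNeg of pos (- r) : sign_spec r false true.

Lemma signP r : sign_spec r (pos r) (pos (- r)).
Proof.
have [->|n0] := EM (r = 0); first by rewrite oppr0 pos0; constructor.
have [p|p] := pos_total n0; first by rewrite p posN //; constructor.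
by rewrite -{2}[r]opprK (posN p) p; constructor.
Qed.

Lemma ge0_0 : ge0 0. Proof. by rewrite /ge0 oppr0 pos0. Qed.
Lemma pos_ge0 r : pos r -> ge0 r. Proof. by move=> p; rewrite /ge0 posN. Qed.
Lemma ge0P r : ge0 r <-> (r = 0 \/ pos r).
Proof.
rewrite /ge0; split=> [|[->|/posN->//]]; last by rewrite oppr0 pos0.
by case: (signP r); [left|right|].
Qed.
Lemma pos_ge0D r s : pos r -> ge0 s -> pos (r + s).
Proof. by move=> p /ge0P[->|]; [rewrite addr0|apply: posD]. Qed.
Lemma ge0D r s : ge0 r -> ge0 s -> ge0 (r + s).
Proof.
by move=> /ge0P[->|p] q; [rewrite add0r|apply/pos_ge0/pos_ge0D].
Qed.
Lemma nposE r : ~~ pos r = ge0 (- r). Proof. by rewrite /ge0 opprK. Qed.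
Lemma ge0_anti r : ge0 r -> ge0 (- r) -> r = 0.
Proof. by rewrite /ge0 opprK; case: (signP r). Qed.
Lemma pos_mulrn r n : (0 < n)%N -> pos (r *+ n) = pos r.
Proof.
case: n => // n _.
have h s : pos s -> pos (s *+ n.+1).
  by move=> p; elim: n => // n IH; rewrite mulrS; apply: posD.
case: (signP r) => [->|/h//|/h]; first by rewrite mul0rn pos0.
by rewrite mulNrn => /posN; rewrite opprK.
Qed.
Lemma ge0_mulrn r n : (0 < n)%N -> ge0 (r *+ n) = ge0 r.
Proof. by move=> n0; rewrite /ge0 -mulNrn pos_mulrn. Qed.
Lemma mulrn_inj n r s : (0 < n)%N -> r *+ n = s *+ n -> r = s.
Proof.
move=> n0 /eqP; rewrite -subr_eq0 -mulrnBl => /eqP e.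
apply: subr0_eq; case: (signP (r - s)) => // p.
  by move: p; rewrite -(pos_mulrn _ n0) e pos0.
by move: p; rewrite -(pos_mulrn _ n0) mulNrn e oppr0 pos0.
Qed.

Definition tsub r s := if pos (r - s) then r - s else 0.

Lemma tsub_ge0 r s : ge0 (tsub r s).
Proof. by rewrite /tsub; case: ifP => [/pos_ge0|_]; last exact: ge0_0. Qed.
Lemma tsub0 r s : ge0 (s - r) -> tsub r s = 0.
Proof. by rewrite /tsub /ge0 opprB; case: ifP. Qed.
Lemma tsubE r s : ge0 (r - s) -> tsub r s = r - s.
Proof. by move/ge0P; rewrite /tsub => -[->|->] //; rewrite pos0. Qed.
Lemma tsub_tsub r s t : ge0 r -> tsub (tsub t s) r = tsub t (r + s).
Proof.
move=> r0; have [h|h] := boolP (ge0 (t - s)).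
  by rewrite (tsubE h) /tsub addrAC opprD addrA.
have ts : ge0 (s - t).
  by rewrite -opprB -nposE; apply: contra h => /pos_ge0.
rewrite (tsub0 ts) !tsub0 ?subr0 //.
by rewrite -addrA; apply: ge0D.
Qed.
Lemma ge0_total r s : ge0 (r - s) \/ ge0 (s - r).
Proof. by rewrite /ge0 !opprB -(opprB r s); case: (signP (r - s)); auto. Qed.
Lemma tsub_max r s : tsub r s + s = tsub s r + r.
Proof.
wlog h : r s / ge0 (r - s) => [W|].
  by case: (ge0_total r s) => /W // ->.
by rewrite (tsubE h) (tsub0 h) add0r subrK.
Qed.
Lemma tsub_min r s : ge0 r -> ge0 s -> tsub r (tsub r s) = tsub s (tsub s r).
Proof.
wlog h : r s / ge0 (r - s) => [W r0 s0|r0 s0].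
  by case: (ge0_total r s) => /W // ->.
rewrite (tsubE h) (tsub0 h) !tsubE ?subr0 //; first by rewrite opprB addrC subrK.
by rewrite opprB addrC subrK.
Qed.
Lemma tsubDK r s : ge0 s -> tsub (s + r) r = s.
Proof. by move=> s0; rewrite tsubE addrK. Qed.
Lemma tsubr0 r : ge0 r -> tsub r 0 = r.
Proof. by move=> r0; rewrite tsubE subr0. Qed.
Lemma tsubrr r : tsub r r = 0.
Proof. by rewrite tsub0 // subrr ge0_0. Qed.
Lemma tsub0r r : ge0 r -> tsub 0 r = 0.
Proof. by move=> r0; rewrite tsub0 // subr0. Qed.
Lemma tsub_mulrn r s n : (0 < n)%N -> tsub (r *+ n) (s *+ n) = tsub r s *+ n.
Proof.
by move=> n0; rewrite /tsub -mulrnBl pos_mulrn //; case: ifP; rewrite ?mul0rn.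
Qed.

End OrderedGroups.

(* The algebra Gamma(Z lex G, (1, 0)): the pair of [false] and r stands for (0, r)
   and the pair of [true] and r for (1, -r). *)
Record gamma (G : ogroup) := Gamma { bit : bool; mag : G; mag_ge0 : ge0 mag }.
Arguments Gamma {G} bit {mag}.

Section Gamma.
Local Open Scope mv_scope.
Variable G : ogroup.
Implicit Types x y z : gamma G.

Lemma gamma_eq x y : bit x = bit y -> mag x = mag y -> x = y.
Proof.
case: x y => b r p [c s q] /= e; case: c / e => e; case: s / e q => q.
by rewrite (bool_irrelevance p q).
Qed.

(** Sums are truncated at (1, 0): (0, r) + (1, -s) is (1, -(s - r)) if s exceeds r and (1, 0)
    otherwise, while two elements of the upper half always add up to (1, 0). *)
Definition gadd_mag x y : G :=
  match bit x, bit y with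
  | false, false => (mag x + mag y)%R
  | true, true => 0%R
  | false, true => tsub (mag y) (mag x)
  | true, false => tsub (mag x) (mag y)
  end.

Lemma gadd_mag_ge0 x y : ge0 (gadd_mag x y).
Proof.
rewrite /gadd_mag; case: (bit x) (bit y) => [] [];
  by [exact: ge0_0|exact: tsub_ge0|apply: ge0D; exact: mag_ge0].
Qed.

HB.instance Definition _ := @hasMVOps.Build (gamma G)
  (Gamma false (ge0_0 G)) (fun x => Gamma (~~ bit x) (mag_ge0 x))
  (fun x y => Gamma (bit x || bit y) (gadd_mag_ge0 x y)).

Let gammaA x y z : x + (y + z) = (x + y) + z.
Proof.
case: x y z => [b r p] [c s q] [d t u].
apply: gamma_eq => /=; first by rewrite orbA.
case: b c d => [] [] []; rewrite /= /gadd_mag /= /gadd_mag /= ?tsub_tsub //;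
  rewrite ?(tsub0r) ?GRing.addrA //; try exact: tsub_ge0.
- by rewrite GRing.addrC.
- by rewrite -!tsub_tsub // !tsub_tsub // GRing.addrC.
Qed.

Let gammaC x y : x + y = y + x.
Proof.
case: x y => [[] r p] [[] s q]; apply: gamma_eq => //=.
by rewrite /gadd_mag /= GRing.addrC.
Qed.
Let gamma0 x : x + 0 = x.
Proof.
by case: x => [[] r p]; apply: gamma_eq; rewrite //= /gadd_mag /= ?tsubr0 ?GRing.addr0.
Qed.
Let gammaK x : mvneg (mvneg x) = x.
Proof. by apply: gamma_eq; rewrite //= negbK. Qed.
Let gamma_neg0 x : x + mvneg 0 = mvneg 0.
Proof.
by case: x => [[] r p]; apply: gamma_eq; rewrite //= /gadd_mag /= tsub0r.
Qed.
Let gammaL x y : mvneg (mvneg x + y) + y = mvneg (mvneg y + x) + x.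
Proof.
case: x y => [[] r p] [[] s q]; apply: gamma_eq;
  rewrite //= /gadd_mag /= /gadd_mag /=.
- exact: tsub_min.
- by rewrite tsubDK // tsubr0.
- by rewrite tsubDK // tsubr0.
- exact: tsub_max.
Qed.

HB.instance Definition _ := @isMVAlgebra.Build (gamma G)
  gammaA gammaC gamma0 gammaK gamma_neg0 gammaL.

Lemma bitN x : bit (mvneg x) = ~~ bit x. Proof. by []. Qed.
Lemma magN x : mag (mvneg x) = mag x. Proof. by []. Qed.
Lemma bitD x y : bit (x + y) = bit x || bit y. Proof. by []. Qed.
Lemma magD x y : mag (x + y) =
  (if bit x then if bit y then 0 else tsub (mag x) (mag y)
   else if bit y then tsub (mag y) (mag x) else mag x + mag y)%R.
Proof. by []. Qed.

(* Multiplication of magnitudes by [n.+1], the term function [mvt n.+1]. *)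
Definition gscale n x : gamma G :=
  Gamma (bit x) (eq_ind_r is_true (mag_ge0 x) (ge0_mulrn (mag x) (ltn0Sn n))).

Lemma gscale_hom n : mvmorphism (gscale n).
Proof.
split=> [|x|x y]; apply: gamma_eq => //=; first exact: GRing.mul0rn.
by rewrite /gadd_mag /=; case: (bit x) (bit y) => [] []; rewrite /=
  ?GRing.mulrnDl ?tsub_mulrn // GRing.mul0rn.
Qed.
Lemma gscale_inj n : injective (gscale n).
Proof.
move=> x y e; apply: gamma_eq; first exact: (congr1 (@bit G) e).
exact: (mulrn_inj (ltn0Sn n) (congr1 (@mag G) e)).
Qed.

(** In the upper half any two summands already give (1, 0), so the magnitude survives only in a sum
    of one term; [(n == 0)] is that indicator. *)
Lemma gamma_nmul n x : bit (nmul n.+1 x) = bit x /\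
  mag (nmul n.+1 x) = if bit x then (mag x *+ (n == 0))%R else (mag x *+ n.+1)%R.
Proof.
elim: n => [|n [IHb IHm]].
  by rewrite [nmul 1 x]mvadd0 GRing.mulr1n if_same.
have -> : nmul n.+2 x = x + nmul n.+1 x by [].
by rewrite bitD magD IHb IHm; case: (bit x).
Qed.

Lemma mvmulE x y : mvmul x y = mvneg (mvneg x + mvneg y). Proof. by []. Qed.

Lemma mvexp_neg n x : mvexp x n = mvneg (mvmuln n (mvneg x)).
Proof.
case: n => // n; rewrite /mvexp /mvmuln !iteropS.
elim: n => [|n IH] /=; first by rewrite mvnegK.
by rewrite IH mvmulE mvnegK.
Qed.

(** For z = (0, r) the square is 0, so the meet in t_k is kz, and z^k is 0, or z if k = 1, hence
    absorbed. For z = (1, -r) twice the square is 1, so the meet is 0 and z^k = (1, -kr) remains. *)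
Lemma gamma_t n x : mvt n.+1 x = gscale n x.
Proof.
apply: gamma_eq; rewrite /mvt !mvexp_neg !nmulE.
  have [b1 m1] := gamma_nmul n x; have [b2 m2] := gamma_nmul n (mvneg x).
  have [b3 m3] := gamma_nmul 1 (mvneg x).
  have [b4 m4] := gamma_nmul 1 (mvneg (nmul 2 (mvneg x))).
  rewrite /mvjoin /mvmeet /mvjoin !(bitN,bitD,b1,b2,b3,b4) /=.
  by case: (bit x).
have [b1 m1] := gamma_nmul n x; have [b2 m2] := gamma_nmul n (mvneg x).
have [b3 m3] := gamma_nmul 1 (mvneg x).
have [b4 m4] := gamma_nmul 1 (mvneg (nmul 2 (mvneg x))).
have M := mag_ge0 x; have Mn : ge0 (mag x *+ n.+1)%R by rewrite ge0_mulrn.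
rewrite /mvjoin /mvmeet /mvjoin.
rewrite !(bitN,bitD,magN,magD,b1,b2,b3,b4,m1,m2,m3,m4).
case: (bit x) => /=; rewrite ?tsubrr ?tsubr0 ?tsub0r ?GRing.add0r //.
rewrite GRing.addr0 tsubr0 //; case: n {b1 m1 b2 m2} Mn => [|n] Mn /=.
  by rewrite GRing.mulr1n tsubrr GRing.add0r.
by rewrite GRing.mulr0n tsubr0 // GRing.addr0.
Qed.

End Gamma.

(** * Representation of chains *)

(** What the lower half of a chain forms under addition. The axioms are those that make the group of
    differences totally ordered with this monoid as its nonnegative part. *)
Record cone := Cone {
  cone_sort :> Type;
  cone0 : cone_sort;
  coneD : cone_sort -> cone_sort -> cone_sort;
  coneA : forall x y z, coneD x (coneD y z) = coneD (coneD x y) z;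
  coneC : forall x y, coneD x y = coneD y x;
  coneD0 : forall x, coneD x cone0 = x;
  cone_cancel : forall x y z, coneD x y = coneD x z -> y = z;
  cone_total : forall x y, exists d, coneD x d = y \/ coneD y d = x;
  cone_pointed : forall x y, coneD x y = cone0 -> x = cone0
}.

Section GrothendieckGroup.
Variable C : cone.
Local Notation "0" := (cone0 C).
Local Notation "x + y" := (coneD x y).
Implicit Types (x y z d : C) (p q : C * C).

Definition same_diff p q := p.1 + q.2 = q.1 + p.2.

Lemma coneCA x y z : x + (y + z) = y + (x + z).
Proof. by rewrite !coneA (coneC x). Qed.
Lemma coneACA x y z t : (x + y) + (z + t) = (x + z) + (y + t).
Proof. by rewrite -!coneA (coneCA y). Qed.

Definition groth := classes same_diff.
Definition diff p : groth := class_of same_diff p.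

Lemma diffP p q : diff p = diff q <-> same_diff p q.
Proof.
apply: class_ofP => // -[a b] [c d] [e f]; rewrite /same_diff /=.
move=> h k; apply: (@cone_cancel _ d).
by rewrite coneCA coneA h -coneA (coneC b) coneA k -coneA coneCA.
Qed.
Lemma diff_repr u : diff (class_repr u) = u. Proof. exact: class_reprK. Qed.
Lemma same_repr p : same_diff (class_repr (diff p)) p.
Proof. by apply/diffP; rewrite diff_repr. Qed.
Lemma diff_ind (P : groth -> Prop) : (forall p, P (diff p)) -> forall u, P u.
Proof. by move=> h u; rewrite -(diff_repr u). Qed.

Definition gsum (u v : groth) : groth :=
  let p := class_repr u in let q := class_repr v in diff (p.1 + q.1, p.2 + q.2).
Definition gopp (u : groth) : groth := let p := class_repr u in diff (p.2, p.1).

Lemma gsumE p q : gsum (diff p) (diff q) = diff (p.1 + q.1, p.2 + q.2).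
Proof.
apply/diffP; have := same_repr p; have := same_repr q; rewrite /same_diff /=.
by move=> h k; rewrite coneACA h k coneACA.
Qed.
Lemma goppE p : gopp (diff p) = diff (p.2, p.1).
Proof.
apply/diffP; have := same_repr p; rewrite /same_diff /=.
by rewrite (coneC _ p.1) => <-; rewrite coneC.
Qed.

Let gsumA u v w : gsum u (gsum v w) = gsum (gsum u v) w.
Proof.
elim/diff_ind: u => u; elim/diff_ind: v => v; elim/diff_ind: w => w.
by rewrite !gsumE /= !coneA.
Qed.
Let gsumC u v : gsum u v = gsum v u.
Proof.
elim/diff_ind: u => u; elim/diff_ind: v => v.
by rewrite !gsumE /= (coneC u.1) (coneC u.2).
Qed.
Let gsum0 u : gsum (diff (0, 0)) u = u.
Proof.
by elim/diff_ind: u => -[x y]; rewrite gsumE /= !(coneC 0) !coneD0.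
Qed.
Let gsumN u : gsum (gopp u) u = diff (0, 0).
Proof.
elim/diff_ind: u => -[x y]; rewrite goppE gsumE /=; apply/diffP.
by rewrite /same_diff /= coneD0 [RHS]coneC coneD0 coneC.
Qed.

HB.instance Definition _ := gen_eqMixin groth.
HB.instance Definition _ := gen_choiceMixin groth.
HB.instance Definition _ := GRing.isZmodule.Build groth gsumA gsumC gsum0 gsumN.

Definition cone_inj d : groth := diff (d, 0).

Lemma cone_inj0 : cone_inj 0 = 0%R. Proof. by []. Qed.
Lemma cone_injD x y : cone_inj (x + y) = (cone_inj x + cone_inj y)%R.
Proof. by rewrite [RHS]gsumE /= coneD0. Qed.
Lemma cone_inj_inj : injective cone_inj.
Proof. by move=> x y /diffP; rewrite /same_diff /= !coneD0. Qed.
Lemma cone_inj_total (u : groth) : exists d, u = cone_inj d \/ (- u)%R = cone_inj d.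
Proof.
elim/diff_ind: u => -[x y]; have [d [e|e]] := cone_total x y; exists d.
  by right; apply: etrans (goppE _) _; apply/diffP; rewrite /same_diff /= coneD0 coneC.
by left; apply/diffP; rewrite /same_diff /= coneD0 coneC.
Qed.

Definition groth_pos (u : groth) := `[< exists2 d, d <> 0 & u = cone_inj d >].

Let groth_pos0 : groth_pos 0%R = false.
Proof. by apply/asboolP => -[d d0] /cone_inj_inj e; apply: d0. Qed.
Let groth_posD (u v : groth) : groth_pos u -> groth_pos v -> groth_pos (u + v)%R.
Proof.
move=> /asboolP[x x0 ->] /asboolP[y y0 ->]; apply/asboolP; exists (x + y).
  by move/cone_pointed.
by rewrite cone_injD.
Qed.
Let groth_total (u : groth) : u <> 0%R -> groth_pos u \/ groth_pos (- u)%R.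
Proof.
move=> u0; have [d [e|e]] := cone_inj_total u; [left|right];
  apply/asboolP; exists d => // d0; apply: u0.
  by rewrite e d0.
by rewrite -[u]GRing.opprK e d0 cone_inj0 GRing.oppr0.
Qed.

Definition groth_ogroup : ogroup := Ogroup groth_pos0 groth_posD groth_total.

Lemma cone_inj_ge0 d : @ge0 groth_ogroup (cone_inj d).
Proof.
apply/ge0P; have [->|d0] := EM (d = 0); first by left.
by right; apply/asboolP; exists d.
Qed.
Lemma ge0_cone_inj (u : groth_ogroup) : ge0 u -> exists d, u = cone_inj d.
Proof.
by move/ge0P => [->|/asboolP[d _ ->]]; [exists 0|exists d].
Qed.

End GrothendieckGroup.

(* The identity that axiomatizes VP among MV-algebras (only necessity is used). *)
Definition chang (A : mvType) := forall x : A,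
  mvmuln 2 (mvexp x 2) = mvexp (mvmuln 2 x) 2.

Section ChangChain.
Local Open Scope mv_scope.
Variables (B : mvType) (changB : chang B).
Hypothesis total : forall x y : B, mle x y \/ mle y x.
Hypothesis nontrivial : 0 <> mv1 B.
Implicit Types x y z : B.

Definition small x := mle x (mvneg x).

Lemma small_sq x : small x <-> mvmul x x = 0.
Proof.
split=> [h|h]; first by rewrite /mvmul h mvneg1.
by apply: mvneg_inj; rewrite mvneg1.
Qed.
Lemma small0 : small 0. Proof. exact: mle0. Qed.
(** This is where the identity [chang] enters: it turns x^2 = 0 into (2x)^2 = 0. Without it the
    lower half would not be closed under addition. *)
Lemma small_double x : small x -> small (x + x).
Proof.
by move=> /small_sq h; apply/small_sq; rewrite -[LHS]changB /mvmuln /mvexp /= h mvadd0.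
Qed.
Lemma small_mle x y : mle x y -> small y -> small x.
Proof. by move=> xy h; apply: mle_trans xy (mle_trans h (mle_neg xy)). Qed.
Lemma smallD x y : small x -> small y -> small (x + y).
Proof.
move=> hx hy; case: (total x y) => h.
  by apply: small_mle (small_double hy); apply: mle_add2 h (mle_refl _).
by apply: small_mle (small_double hx); apply: mle_add2 (mle_refl _) h.
Qed.
Lemma small_orth x y : small x -> small y -> mle x (mvneg y).
Proof.
move=> hx hy; case: (total x y) => h; last exact: mle_trans hx (mle_neg h).
exact: mle_trans h hy.
Qed.
Lemma small_or x : small x \/ small (mvneg x).
Proof. by rewrite /small mvnegK; apply: total. Qed.
(** Otherwise x equals its negation, so 1 = 2x would be small and hence 0. *)
Lemma small_excl x : small x -> small (mvneg x) -> False.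
Proof.
rewrite {2}/small mvnegK => h k; have := small_double h.
rewrite {2}(mle_anti h k) mvadd_negx /small mvneg1 => /mle_x0 e.
by apply: nontrivial; rewrite e.
Qed.
Lemma small_cancel x y z : small x -> small y -> small z -> x + y = x + z -> y = z.
Proof. by move=> hx hy hz; apply: add_cancel; apply: small_orth. Qed.

Definition small_type := {x | small x}.
Implicit Types r s t : small_type.
Definition small_zero : small_type := exist _ 0 small0.
Definition small_add r s : small_type := exist _ _ (smallD (svalP r) (svalP s)).

Lemma small_eq r s : sval r = sval s -> r = s.
Proof. by move: r s => [x hx] [y hy] /= e; apply: eq_exist. Qed.

Let small_addA r s t : small_add r (small_add s t) = small_add (small_add r s) t.
Proof. by apply: small_eq; apply: mvaddA. Qed.
Let small_addC r s : small_add r s = small_add s r.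
Proof. by apply: small_eq; apply: mvaddC. Qed.
Let small_add0 r : small_add r small_zero = r.
Proof. by apply: small_eq; apply: mvadd0. Qed.
Let small_add_cancel r s t : small_add r s = small_add r t -> s = t.
Proof.
case: r s t => [x hx] [y hy] [z hz] /(congr1 sval) /= h; apply: small_eq => /=.
exact: small_cancel h.
Qed.
Let small_total r s : exists d, small_add r d = s \/ small_add s d = r.
Proof.
case: r s => [x hx] [y hy].
have sm u v : small u -> small (mvsub u v) by apply: small_mle; apply: sub_le.
case: (total x y) => h.
  exists (exist _ _ (sm y x hy)); left; apply: small_eq => /=.
  by rewrite mvaddC mle_subK.
exists (exist _ _ (sm x y hx)); right; apply: small_eq => /=.
by rewrite mvaddC mle_subK.
Qed.
Let small_pointed r s : small_add r s = small_zero -> r = small_zero.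
Proof.
case: r s => [x hx] [y hy] /(congr1 sval) /= h; apply: small_eq => /=.
by apply: mle_x0; rewrite -h; apply: mle_addr.
Qed.
Definition small_cone : cone :=
  Cone small_addA small_addC small_add0 small_add_cancel small_total small_pointed.

Local Notation G := (groth_ogroup small_cone).

Definition chain_bit x := ~~ `[< small x >].
Lemma chain_mag_subproof x : small (if chain_bit x then mvneg x else x).
Proof.
by rewrite /chain_bit; case: asboolP => //= h; case: (small_or x).
Qed.
Definition chain_mag x : small_cone := exist _ _ (chain_mag_subproof x).
Definition chain_map x : gamma G := Gamma (chain_bit x) (cone_inj_ge0 (chain_mag x)).

Lemma chain_bitN x : chain_bit (mvneg x) = ~~ chain_bit x.
Proof.
rewrite /chain_bit negbK; case: asboolP => h; case: asboolP => k //=.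
  by case: (small_excl k h).
by case: (small_or x).
Qed.

Lemma chain_mag_eq x r : sval r = (if chain_bit x then mvneg x else x) ->
  mag (chain_map x) = cone_inj (r : small_cone).
Proof. by move=> e; congr (cone_inj _); apply: small_eq. Qed.

(** Additivity is checked by halves: [addE] for two small summands, [subE] for a small and a large
    one, through r + neg s = neg (s - r); two large elements add up to 1. *)
Lemma chain_map_hom : mvmorphism chain_map.
Proof.
have b0 x : small x -> chain_bit x = false.
  by move=> h; rewrite /chain_bit; case: asboolP.
have bN x : small (mvneg x) -> chain_bit x.
  by move=> h; rewrite -[chain_bit x]negbK -chain_bitN b0.
have addE r s : chain_map (sval r + sval s) = chain_map (sval r) + chain_map (sval s).
  have [hr hs] := (svalP r, svalP s); have hrs := smallD hr hs.
  apply: gamma_eq; first by rewrite bitD /= !b0.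
  rewrite magD /= !b0 //= -cone_injD; congr (cone_inj _).
  by apply: small_eq; rewrite /= !b0.
have subE r s : chain_map (sval r + mvneg (sval s)) =
    chain_map (sval r) + chain_map (mvneg (sval s)).
  have [hr hs] := (svalP r, svalP s).
  have hsr : small (mvsub (sval s) (sval r)) by apply: small_mle hs; apply: sub_le.
  have e : sval r + mvneg (sval s) = mvneg (mvsub (sval s) (sval r)).
    by rewrite /mvsub mvnegK mvaddC.
  have bs : chain_bit (mvneg (sval s)) by apply: bN; rewrite mvnegK.
  have bsr : chain_bit (mvneg (mvsub (sval s) (sval r))) by apply: bN; rewrite mvnegK.
  apply: gamma_eq; first by rewrite bitD e /= bs bsr orbT.
  have br : bit (chain_map (sval r)) = false := b0 _ hr.
  have bs' : bit (chain_map (mvneg (sval s))) = true := bs.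
  rewrite magD br bs' e.
  rewrite (@chain_mag_eq _ (exist _ _ hsr)) ?bsr ?mvnegK //.
  rewrite (@chain_mag_eq _ s) ?bs ?mvnegK // (@chain_mag_eq _ r) ?b0 //.
  case: (total (sval r) (sval s)) => h.
    have -> : cone_inj (s : small_cone) =
        (cone_inj (exist _ _ hsr : small_cone) + cone_inj (r : small_cone))%R.
      by rewrite -cone_injD; congr (cone_inj _); apply: small_eq; rewrite /= mle_subK.
    by rewrite tsubDK //; apply: cone_inj_ge0.
  have z : exist _ _ hsr = cone0 small_cone.
    by apply: small_eq => /=; apply/sub_eq0.
  have hrs : small (mvsub (sval r) (sval s)) by apply: small_mle hr; apply: sub_le.
  rewrite z tsub0 //.
  have -> : cone_inj (r : small_cone) =
      (cone_inj (exist _ _ hrs : small_cone) + cone_inj (s : small_cone))%R.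
    by rewrite -cone_injD; congr (cone_inj _); apply: small_eq; rewrite /= mle_subK.
  by rewrite GRing.addrK; apply: cone_inj_ge0.
have one : chain_map (mv1 B) = mv1 _.
  apply: gamma_eq => /=; first by rewrite bN // mvneg1; apply: small0.
  rewrite -(cone_inj0 small_cone); congr (cone_inj _); apply: small_eq => /=.
  by rewrite bN mvneg1 //; apply: small0.
split.
- apply: gamma_eq => /=; first by rewrite b0 //; apply: small0.
  rewrite -(cone_inj0 small_cone); congr (cone_inj _); apply: small_eq => /=.
  by rewrite b0 //; apply: small0.
- move=> x; apply: gamma_eq => /=; first exact: chain_bitN.
  congr (cone_inj _).
  by apply: small_eq; rewrite /= chain_bitN; case: (chain_bit x); rewrite /= ?mvnegK.
- move=> x y; case: (small_or x) (small_or y) => hx [] hy.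
  + exact: (addE (exist _ _ hx) (exist _ _ hy)).
  + by have := subE (exist _ _ hx) (exist _ _ hy); rewrite /= !mvnegK.
  + rewrite mvaddC (mvaddC (chain_map x)).
    by have := subE (exist _ _ hy) (exist _ _ hx); rewrite /= !mvnegK.
  + have -> : x + y = mv1 B.
      by have := small_orth hx hy; rewrite /mle !mvnegK.
    rewrite one; apply: gamma_eq => /=; first by rewrite bN.
    by rewrite [RHS]magD /= !bN.
Qed.

Lemma chain_map_inj : injective chain_map.
Proof.
move=> x y e; have b : chain_bit x = chain_bit y := congr1 (@bit G) e.
have /(congr1 sval) /= := cone_inj_inj (congr1 (@mag G) e).
by rewrite b; case: ifP => // _; apply: mvneg_inj.
Qed.

Lemma chain_map_surj u : exists x, chain_map x = u.
Proof.
have [r e] := ge0_cone_inj (mag_ge0 u); have h := svalP r.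
have b0 : chain_bit (sval r) = false by rewrite /chain_bit; case: asboolP.
exists (if bit u then mvneg (sval r) else sval r).
case: ifP => bu; (apply: gamma_eq => /=; first by rewrite ?chain_bitN b0 bu);
  by rewrite e; congr (cone_inj _); apply: small_eq; rewrite /= ?chain_bitN b0 //= mvnegK.
Qed.

End ChangChain.

(** * The variety generated by perfect MV-algebras *)

Section ChainQuotients.
Local Open Scope mv_scope.
Variable A : mvType.
Implicit Types x y : A.

(** The case of a single equation x = y without unknowns, whose candidates form [unit]:
    unsolvability means that x and y stay distinct, and patching is trivial. *)
Lemma chain_separation x y : x <> y ->
  exists R (cR : congruence R), ~ R x y /\
    forall q q' : quot cR, mle q q' \/ mle q' q.
Proof.
move=> nxy; pose L (_ : unit) (_ : nat) := (x, y).
have solE S : solvable_mod 1 L S <-> S x y.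
  by split=> [[z /(_ 0%N isT)]|h] //; exists tt => -[|i].
have [|R S _ _ /solE h /solE k|R [cR [/solE nR tot]]] := @unsolvable_chain A unit 1 L.
- by move/solE.
- exact/solE.
- by exists R, cR.
Qed.

Lemma mvleP x y : mvle x y <-> mle x y.
Proof. by split=> [<-|/join_idPr //]; apply: mle_joinl. Qed.

Lemma ideal_nmul (I : set A) n x : mvideal I -> I x -> I (nmul n x).
Proof.
move=> [[y Iy] Id IA] Ix; elim: n => [|n IH]; last exact: IA.
by apply: Id Iy; apply/mvleP/mle0.
Qed.

Lemma ideal1 (I : set A) : mvideal I -> I (mv1 A) -> I = setT.
Proof.
move=> [_ Id _] I1; apply/seteqP; split=> // x _.
by apply: Id I1; apply/mvleP/mle1.
Qed.

End ChainQuotients.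

(** * Maximal ideals and the radical *)

Section MaximalIdeals.
Local Open Scope mv_scope.

(** A proper maximal congruence is a maximal one that does not solve the equation 0 = 1. By
    maximality [theta u] identifies 0 and 1 in the quotient, so a multiple of u reaches 1. *)
Lemma simple_quotient (A : mvType) : 0 <> mv1 A ->
  exists (R : A -> A -> Prop) (cR : congruence R), 0 <> mv1 (quot cR) /\
    forall u : quot cR, u <> 0 -> exists n, nmul n u = mv1 _.
Proof.
move=> n01; pose L (_ : unit) (_ : nat) := (0 : A, mv1 A).
have solE S : solvable_mod 1 L S <-> S 0 (mv1 A).
  by split=> [[z /(_ 0%N isT)]|h] //; exists tt => -[|i].
have [|R [cR nR maxR]] := @maximal_unsolvable A unit 1 L; first by move/solE.
exists R, cR; split=> [e|u u0].
  by apply: nR; apply/solE/(clsP cR); rewrite (hom0 (cls_hom cR)) (hom1 (cls_hom cR)).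
have c := @theta_congr (quot cR) u.
have /solE [n [_ h]] : solvable_mod 1 L (fun x y => theta u (cls cR x) (cls cR y)).
  apply: maxR => [|x y /(clsP cR) ->|le]; last 2 first.
  - by case: c.
  - apply: u0; rewrite -(repK u) -[0]repK; apply/(clsP cR)/le.
    by rewrite !repK; apply: theta_gen.
  case: c => r s t n a; split=> [x|x y|x y z|x y|x y x' y'].
  - exact: r.
  - exact: s.
  - exact: t.
  - by rewrite -!clsN; apply: n.
  - by rewrite -!clsD; apply: a.
exists n; apply: mle_anti (mle1 _) _.
by move: h; rewrite mv0add (hom1 (cls_hom cR)).
Qed.

(** If a larger ideal contains u outside the kernel, some nu is mapped to 1; then the negation of nu
    lies in the kernel, and the ideal contains their sum 1. *)
Lemma maximal_kernel (A B : mvType) (f : A -> B) : mvmorphism f ->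
  0 <> mv1 B -> (forall u : B, u <> 0 -> exists n, nmul n u = mv1 B) ->
  maximal_ideal [set x | f x = 0].
Proof.
move=> hf n01 simpleB.
have idK : mvideal [set x | f x = 0].
  split=> [|x y /mvleP /(hom_mle hf) h /= e|x y /= ex ey].
  - by exists 0; apply: hom0.
  - by apply: mle_x0; rewrite -e.
  - by rewrite homD // ex ey mvadd0.
split=> // [/seteqP[_ /(_ (mv1 A) I)] /= e|J idJ nJ IJ].
  by apply: n01; rewrite -e hom1.
apply/seteqP; split=> // u Ju; apply: contrapT => /simpleB[n e].
apply: nJ; apply: ideal1 => //; rewrite -(mvadd_negx (nmul n u)).
case: (idJ) => _ _; apply; first exact: ideal_nmul.
by apply: IJ; rewrite /= homN // hom_nmul // e mvneg1.
Qed.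

(** A nonzero square survives in a chain quotient, where totality gives 2a = 1. This persists in a
    simple quotient of the chain; the kernel of the composite is a maximal ideal, so it contains a,
    which makes 1 = 0 there. *)
Lemma radical_sq (A : mvType) (a : A) : radical A a -> mvmul a a = 0.
Proof.
move=> rad; apply: contrapT => /chain_separation[R [cR [/(clsP cR) nR tot]]].
pose p := cls cR; have hp : mvmorphism p := cls_hom cR.
have dbl : p a + p a = mv1 _.
  case: (tot (p a) (mvneg (p a))) => h; last by move: h; rewrite /mle mvnegK.
  by case: nR; rewrite -/p hom_mul // hom0 // /mvmul h mvneg1.
have n01 : 0 <> mv1 (quot cR).
  move=> e; apply: nR; apply: mle_anti.
    by apply: mle_trans (mle1 _) _; rewrite -e; apply: mle0.
  by apply: mle_trans (mle1 _) _; rewrite -e; apply: mle0.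
have [S [cS [n01' simple]]] := simple_quotient n01.
pose q := cls cS; have hq : mvmorphism q := cls_hom cS.
have M := maximal_kernel (hom_comp hp hq) n01' simple.
apply: n01'; rewrite -(hom1 hq) -dbl homD //.
by have /= -> := rad _ M; rewrite mvadd0.
Qed.

End MaximalIdeals.

Section Variety.
Local Open Scope mv_scope.

(** For a in the radical both a and 2a square to 0. So both sides are 0 at a and 1 at its
    negation. *)
Lemma chang_perfect (A : mvType) : perfect A -> chang A.
Proof.
move=> [_ full] x; have dbl a : radical A a -> mvmul (a + a) (a + a) = 0.
  move=> rad; apply: radical_sq => I MI; have [[_ _ IA] _ _] := MI.
  by apply: IA; apply: rad.
rewrite /mvexp /mvmuln /=; have : [set: A] x by []; rewrite full => -[|[a]] rad.
  by rewrite radical_sq // dbl // mvadd0.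
move=> <-; have e2 : mvneg a + mvneg a = mv1 A.
  by rewrite -[LHS]mvnegK -/(mvmul a a) radical_sq.
rewrite e2 /mvmul !mvneg1 mvadd0 !mvnegK.
by rewrite -[LHS]mvnegK -/(mvmul (a + a) (a + a)) dbl.
Qed.

Lemma chang_variety : variety chang.
Proof.
split.
- move=> A B f hf surj cA y; have [x <-] := surj y.
  by rewrite -!(hom_muln hf, hom_exp hf) cA.
- move=> A B f hf inj cB x; apply: inj.
  by rewrite !(hom_muln hf, hom_exp hf) cB.
- move=> I F cF x; apply: functional_extensionality_dep => i.
  exact: (cF i (x i)).
Qed.

Lemma VP_chang A : VP A -> chang A.
Proof. by apply; [exact: chang_variety|exact: chang_perfect]. Qed.

Lemma VP_hom (A B : mvType) (f : A -> B) : mvmorphism f ->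
  (forall b, exists a, f a = b) -> VP A -> VP B.
Proof.
move=> hf surj vA W vW PW; have [h _ _] := vW.
by apply: h hf surj _; apply: vA.
Qed.

(** The lower half is the only maximal ideal: an ideal with an element y of the upper half contains
    y + y = 1. *)
Lemma VP_gamma (G : ogroup) : VP (gamma G).
Proof.
move=> W _; apply; split.
  by exists 0, (mv1 _) => /(congr1 (@bit G)).
pose J := [set x : gamma G | bit x = false].
have idJ : mvideal J.
  split=> [|x y /mvleP /(congr1 (@bit G)) /= h|x y]; rewrite /J /=.
  - by exists 0.
  - by move=> e; move: h; rewrite e orbF; case: (bit x).
  - by move=> -> ->.
have radJ (x : gamma G) : bit x = false -> radical (gamma G) x.
  move=> bx I [idI nI maxI]; rewrite -(maxI J idJ) //.
    by move=> /seteqP[_ /(_ (mv1 _) Logic.I)].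
  move=> y Iy; rewrite /J /=; apply/negbTE/negP => bY.
  apply: nI; apply: ideal1 => //; have -> : mv1 (gamma G) = y + y.
    by apply: gamma_eq; [rewrite bitD bY|rewrite magD bY].
  by case: (idI) => _ _; apply.
apply/seteqP; split=> // x _; case e: (bit x); [right|by left; apply: radJ].
by exists (mvneg x); [apply: radJ; rewrite bitN e|rewrite mvnegK].
Qed.

Lemma gamma_separation (A : mvType) (x y : A) : chang A -> x <> y ->
  exists (G : ogroup) (f : A -> gamma G),
    [/\ mvmorphism f, forall u, exists a, f a = u & f x <> f y].
Proof.
move=> cA /chain_separation[R [cR [/(clsP cR) nR tot]]].
have cB : chang (quot cR).
  have [h _ _] := chang_variety.
  by apply: h (cls_hom cR) _ cA; apply: cls_surj.
have n01 : 0 <> mv1 (quot cR).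
  move=> e; apply: nR; apply: mle_anti.
    by apply: mle_trans (mle1 _) _; rewrite -e; apply: mle0.
  by apply: mle_trans (mle1 _) _; rewrite -e; apply: mle0.
pose g := chain_map cB tot; exists _, (g \o cls cR); split.
- by apply: hom_comp (cls_hom cR) _; apply: chain_map_hom.
- move=> u; have [b <-] := chain_map_surj n01 u.
  by have [a <-] := cls_surj b; exists a.
- by move/chain_map_inj.
Qed.

End Variety.

(** * Quantifier elimination for ordered abelian groups *)

(** Elimination fails over the trivial group: removing z from the single constraint z > 0 leaves the
    empty, true conjunction. *)
Definition nontrivial_og (G : ogroup) := exists g : G, pos g.

Section LinearForms.
Import Order.TTheory GRing.Theory Num.Theory.
Local Open Scope ring_scope.
Variable V : finType.

Definition linform := {ffun V -> int}.
Implicit Types c d : linform.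

Definition ev (G : zmodType) c (y : V -> G) : G := \sum_i y i *~ c i.

Section Evaluation.
Variable G : zmodType.
Implicit Types y : V -> G.

Lemma ev0 y : ev 0 y = 0.
Proof. by apply: big1 => i _; rewrite ffunE. Qed.
Lemma evD c d y : ev (c + d) y = ev c y + ev d y.
Proof.
by rewrite /ev -big_split; apply: eq_bigr => i _; rewrite ffunE mulrzDr.
Qed.
Lemma evN c y : ev (- c) y = - ev c y.
Proof.
by apply: (addrI (ev c y)); rewrite -evD !subrr ev0.
Qed.
Lemma evB c d y : ev (c - d) y = ev c y - ev d y.
Proof. by rewrite evD evN. Qed.
Lemma evMn c n y : ev (c *+ n) y = ev c y *+ n.
Proof. by elim: n => [|n IH]; rewrite ?ev0 // !mulrS evD IH. Qed.
Lemma ev_zero c : ev c (fun=> 0 : G) = 0.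
Proof. by apply: big1 => i _; rewrite mul0rz. Qed.
Lemma ev_add c y z : ev c (fun i => y i + z i) = ev c y + ev c z.
Proof. by rewrite /ev -big_split; apply: eq_bigr => i _; rewrite mulrzDl. Qed.
Lemma ev_muln c y n : ev c (fun i => y i *+ n) = ev c y *+ n.
Proof.
elim: n => [|n IH]; first exact: ev_zero.
by rewrite mulrS -IH -ev_add; congr (ev c _); apply/funext => i; rewrite mulrS.
Qed.
Lemma ev_comb c (g : G) (k : V -> int) : ev c (fun i => g *~ k i) = g *~ ev c k.
Proof.
rewrite /ev raddf_sum /=; apply: eq_bigr => i _.
by rewrite -mulrzA mulrzz.
Qed.

Definition fvar i : linform := [ffun j => (j == i)%:Z].
Lemma ev_var i y : ev (fvar i) y = y i.
Proof.
rewrite /ev (bigD1 i) //= ffunE eqxx mulr1z big1 ?addr0 // => j ji.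
by rewrite ffunE (negbTE ji) mulr0z.
Qed.

Definition upd y v z i := if i == v then z else y i.
Lemma ev_upd c y v z : ev c (upd y v z) = z *~ c v + ev c (upd y v 0).
Proof.
rewrite /ev (bigD1 v) //= [in RHS](bigD1 v) //= /upd !eqxx mul0rz add0r.
by congr (_ + _); apply: eq_bigr => i /negbTE ->.
Qed.
Lemma ev_upd0 c y v z : c v = 0 -> ev c (upd y v z) = ev c y.
Proof.
move=> c0; apply: eq_bigr => i _; rewrite /upd; case: eqP => // ->.
by rewrite c0 !mulr0z.
Qed.
End Evaluation.

(** The bit [true] marks a strict inequality. *)
Definition constraint := (bool * linform)%type.
Definition chk (G : ogroup) (b : bool) (g : G) := if b then pos g else ge0 g.
Definition csat (G : ogroup) (y : V -> G) (p : constraint) := chk p.1 (ev p.2 y).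

Lemma chkD (G : ogroup) b b' (g h : G) : chk b g -> chk b' h -> chk (b || b') (g + h).
Proof.
case: b b' => [] []; rewrite /chk /=; last exact: ge0D.
- exact: posD.
- exact: pos_ge0D.
- by move=> g0 h0; rewrite addrC pos_ge0D.
Qed.
Lemma chk_mulrn (G : ogroup) b (g : G) n : (0 < n)%N -> chk b (g *+ n) = chk b g.
Proof. by move=> n0; rewrite /chk pos_mulrn // ge0_mulrn. Qed.

(** Quantifier-free formulas as decision trees on signs. Terms translate into them by branching,
    connectives act on the leaves, and the paths to true leaves form a disjunctive normal form. *)
Inductive tree := TLeaf of bool | TNode of linform & tree & tree.

Fixpoint tsat (G : ogroup) (T : tree) (y : V -> G) : bool :=
  match T with
  | TLeaf b => b
  | TNode c T1 T2 => if pos (ev c y) then tsat T1 y else tsat T2 y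
  end.

Fixpoint tneg T := match T with
  | TLeaf b => TLeaf (~~ b) | TNode c T1 T2 => TNode c (tneg T1) (tneg T2) end.
Fixpoint tor T U := match T with
  | TLeaf b => if b then TLeaf true else U
  | TNode c T1 T2 => TNode c (tor T1 U) (tor T2 U) end.
Definition tand T U := tneg (tor (tneg T) (tneg U)).

Fixpoint tforms T : seq linform := match T with
  | TLeaf _ => [::] | TNode c T1 T2 => c :: tforms T1 ++ tforms T2 end.

Definition tconj (P : seq constraint) : tree :=
  foldr (fun p T => if p.1 then TNode p.2 T (TLeaf false)
                    else TNode (- p.2) (TLeaf false) T) (TLeaf true) P.

Fixpoint tpaths T : seq (seq constraint) := match T with
  | TLeaf b => if b then [:: [::]] else [::]
  | TNode c T1 T2 => [seq (true, c) :: P | P <- tpaths T1]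
                  ++ [seq (false, - c) :: P | P <- tpaths T2] end.

Section Sat.
Variable G : ogroup.
Implicit Types y : V -> G.

Lemma tsat_neg T y : tsat (tneg T) y = ~~ tsat T y.
Proof. by elim: T => //= c T1 -> T2 ->; case: ifP. Qed.
Lemma tsat_or T U y : tsat (tor T U) y = tsat T y || tsat U y.
Proof. by elim: T => [[]|c T1 IH1 T2 IH2] //=; rewrite IH1 IH2; case: ifP. Qed.
Lemma tsat_and T U y : tsat (tand T U) y = tsat T y && tsat U y.
Proof. by rewrite tsat_neg tsat_or !tsat_neg negb_or !negbK. Qed.
Lemma tsat_conj P y : tsat (tconj P) y = all (csat y) P.
Proof.
elim: P => [|[[] c] P IH] //=; rewrite -IH /csat /chk /=; case: ifP => //.
  by rewrite /ge0 -evN => ->.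
by rewrite /ge0 -evN => ->.
Qed.
Lemma tsat_paths T y : tsat T y = has (all (csat y)) (tpaths T).
Proof.
elim: T => [[]|c T1 IH1 T2 IH2] //=.
rewrite has_cat !has_map IH1 IH2.
have hT : preim (cons (true, c)) (all (csat y)) =1
    (fun P => pos (ev c y) && all (csat y) P) by [].
have hF : preim (cons (false, - c)) (all (csat y)) =1
    (fun P => ~~ pos (ev c y) && all (csat y) P).
  by move=> P; rewrite /= {1}/csat /chk /= evN /ge0 opprK.
rewrite (eq_has hT) (eq_has hF); case: (pos _) => /=.
  by rewrite [X in _ || X]has_pred0 orbF.
by rewrite has_pred0.
Qed.
Lemma tsat_muln T y n : tsat T (fun i => y i *+ n.+1) = tsat T y.
Proof. by elim: T => //= c T1 -> T2 ->; rewrite ev_muln pos_mulrn. Qed.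
End Sat.

Lemma tsat_signs (G H : ogroup) T (y : V -> G) (z : V -> H) :
  {in tforms T, forall c, pos (ev c y) = pos (ev c z)} -> tsat T y = tsat T z.
Proof.
elim: T => //= c T1 IH1 T2 IH2 h; rewrite h ?mem_head // IH1 ?IH2 // => d dT;
  by apply: h; rewrite inE mem_cat dT ?orbT.
Qed.

Section FourierMotzkin.
Variable v : V.

(** Constraints are unchanged by positive integer factors, so the nonzero coefficients of [v] can be
    brought to a common absolute value, here the product of all of theirs. *)
Lemma normalize (P : seq constraint) : exists K (P' : seq constraint),
  [/\ (0 < K)%N,
      forall p : constraint, p \in P' ->
        [|| p.2 v == 0, p.2 v == K%:Z | p.2 v == - K%:Z] &
      forall (G : ogroup) (y : V -> G), all (csat y) P' = all (csat y) P].
Proof.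
have sc n (G : ogroup) (y : V -> G) Q : (0 < n)%N ->
    all (csat y) [seq (p.1, p.2 *+ n) | p <- Q] = all (csat y) Q.
  move=> n0; rewrite all_map; apply: eq_all => p.
  by rewrite /= /csat /= evMn chk_mulrn.
elim: P => [|[b c] P [K [P' [K0 hP' eqP']]]]; first by exists 1%N, [::].
have [c0|c0] := eqVneq (c v) 0.
  exists K, ((b, c) :: P'); split=> //= [p|G y]; last by rewrite eqP'.
  by rewrite inE => /predU1P[->|/hP'//]; rewrite /= c0 eqxx.
have k0 : (0 < `|c v|)%N by rewrite absz_gt0.
exists (K * `|c v|)%N, ((b, c *+ K) :: [seq (p.1, p.2 *+ `|c v|) | p <- P']).
split; first by rewrite muln_gt0 K0.
  move=> p; rewrite inE => /predU1P[->|/mapP[q /hP' hq ->]] /=.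
    rewrite ffunMnE; case: (ltrgt0P (c v)) => // h; last by rewrite h eqxx in c0.
      by rewrite PoszM gtz0_abs // -mulr_natl natz eqxx orbT.
    by rewrite PoszM ltz0_abs // -mulr_natl natz mulrN opprK eqxx !orbT.
  rewrite ffunMnE PoszM; case/or3P: hq => /eqP ->.
  - by rewrite mul0rn eqxx.
  - by rewrite -mulr_natr natz eqxx orbT.
  - by rewrite -mulr_natr natz mulNr eqxx !orbT.
by move=> G y /=; rewrite sc // eqP' /csat /= evMn chk_mulrn.
Qed.

Lemma least_element (G : ogroup) (s : seq (bool * G)) : s != [::] ->
  exists2 m, m \in s & forall a, a \in s -> ge0 (a.2 - m.2).
Proof.
elim: s => // a [|b s] IH _.
  by exists a; rewrite ?mem_head // => b; rewrite inE => /eqP ->; rewrite subrr ge0_0.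
have [//|m ms hm] := IH _; case: (ge0_total a.2 m.2) => h.
  exists m => [|x]; first by rewrite inE ms orbT.
  by rewrite inE => /predU1P[->//|/hm].
exists a => [|x]; first exact: mem_head.
rewrite inE => /predU1P[->|/hm k]; first by rewrite subrr ge0_0.
by rewrite -(subrKA m.2); apply: ge0D.
Qed.

(* With least elements m of [L] and m' of [U], the point z = m' - m works:
   z + 2a = (m' + a) + (a - m) and 2b - z = (m + b) + (b - m'). *)
Lemma interpolation (G : ogroup) (L U : seq (bool * G)) : nontrivial_og G ->
  (forall a b, a \in L -> b \in U -> chk (a.1 || b.1) (a.2 + b.2)) ->
  exists z, (forall a, a \in L -> chk a.1 (z + a.2 *+ 2)) /\
            (forall b, b \in U -> chk b.1 (b.2 *+ 2 - z)).
Proof.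
move=> [g g0] h.
have weak b (x : G) : pos x -> chk b x by case: b => //; apply: pos_ge0.
have step b b' (x y : G) : chk (b || b') x -> ge0 y -> chk b (x + y).
  move=> hx hy; case: b hx => //= [hx|]; first exact: pos_ge0D.
  by case: b' => [/pos_ge0|] hx; apply: ge0D.
have [->|L0] := eqVneq L [::].
  have [->|U0] := eqVneq U [::]; first by exists 0.
  have [m mU hm] := least_element U0.
  (* Without lower bounds, any point a positive amount below twice the least upper bound satisfies
     even the strict constraints. *)
  exists (m.2 *+ 2 - g); split=> // b /hm hb; apply: weak.
  by rewrite opprB addrCA -mulrnBl; apply: pos_ge0D; rewrite ?ge0_mulrn.
have [m mL hm] := least_element L0.
have [->|U0] := eqVneq U [::].
  exists (g - m.2 *+ 2); split=> // a /hm ha; apply: weak.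
  by rewrite -addrA (addrC (- _)) -mulrnBl; apply: pos_ge0D; rewrite ?ge0_mulrn.
have [m' mU hm'] := least_element U0.
exists (m'.2 - m.2); split=> [a aL|b bU].
  have -> : m'.2 - m.2 + a.2 *+ 2 = (a.2 + m'.2) + (a.2 - m.2).
    by rewrite mulr2n addrACA (addrC m'.2) (addrC (- m.2)).
  by apply: (step _ m'.1); [apply: h|apply: hm].
have -> : b.2 *+ 2 - (m'.2 - m.2) = (m.2 + b.2) + (b.2 - m'.2).
  by rewrite opprB mulr2n addrACA (addrC b.2 m.2).
by apply: (step _ m.1); [rewrite orbC; apply: h|apply: hm'].
Qed.

Lemma fourier_motzkin (P : seq constraint) : exists P' : seq constraint,
  forall (G : ogroup) (y : V -> G), nontrivial_og G ->
  all (csat y) P' <->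
  exists n z, all (csat (upd (fun i => y i *+ n.+1) v z)) P.
Proof.
have [K [Q [K0 hQ eqQ]]] := normalize P.
pose L := [seq p : constraint <- Q | p.2 v == K%:Z].
pose U := [seq p : constraint <- Q | p.2 v == - K%:Z].
pose add (a b : constraint) : constraint := (a.1 || b.1, a.2 + b.2).
exists ([seq p : constraint <- Q | p.2 v == 0] ++ [seq add a b | a <- L, b <- U]).
move=> G y ntG; rewrite all_cat; split=> [/andP[/allP hZ /allP hLU]|[n [z]]].
  pose l (p : constraint) := (p.1, ev p.2 (upd y v 0)).
  have [|z [hL hU]] := @interpolation G [seq l p | p <- L] [seq l p | p <- U] ntG.
    move=> _ _ /mapP[a aL ->] /mapP[b bU ->] /=.
    have := hLU _ (allpairs_f add aL bU).
    rewrite /csat /= -evD ev_upd0 // ffunE.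
    move: aL bU; rewrite !mem_filter => /andP[/eqP -> _] /andP[/eqP -> _].
    by rewrite subrr.
  (* The parameters are multiplied by 2K: by K because [v] has coefficient K or -K, and by 2 because
     [interpolation] clears the denominator of a midpoint. *)
  exists (2 * K).-1, z; rewrite -eqQ; apply/allP => p pQ.
  rewrite prednK ?muln_gt0 ?K0 // /csat ev_upd.
  have -> : ev p.2 (upd (fun i => y i *+ (2 * K)) v 0) = (l p).2 *+ 2 *+ K.
    rewrite /= -mulrnA -ev_muln; congr (ev _ _); apply/funext => i.
    by rewrite /upd; case: ifP; rewrite ?mul0rn.
  case/or3P: (hQ p pQ) => /eqP e.
  - have := hZ p; rewrite mem_filter e eqxx pQ => /(_ isT).
    rewrite /csat mulr0z add0r /= -mulrnA chk_mulrn ?muln_gt0 ?K0 //.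
    by rewrite ev_upd0.
  - rewrite e -pmulrn -mulrnDl chk_mulrn //.
    by apply: (hL (l p)); apply: map_f; rewrite mem_filter e eqxx.
  - rewrite e mulrNz -pmulrn addrC -mulrnBl chk_mulrn //.
    by apply: (hU (l p)); apply: map_f; rewrite mem_filter e eqxx.
rewrite -eqQ => /allP h.
have red (p : constraint) : p.2 v = 0 -> csat (upd (fun i => y i *+ n.+1) v z) p -> csat y p.
  by move=> p0; rewrite /csat ev_upd0 // ev_muln chk_mulrn.
apply/andP; split; apply/allP => p.
  by rewrite mem_filter => /andP[/eqP p0 /h]; apply: red.
case/allpairsP => -[a b] /= [aL bU ->].
move: aL bU; rewrite !mem_filter => /andP[/eqP ea /h ha] /andP[/eqP eb /h hb].
apply: red; first by rewrite /= ffunE ea eb subrr.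
by rewrite /csat /= evD; apply: chkD.
Qed.

End FourierMotzkin.

(* A solution need only exist after scaling, as the group need not be divisible. *)
Lemma eliminate1 v T : exists T', forall (G : ogroup) (y : V -> G),
  nontrivial_og G ->
  tsat T' y <-> exists n z, tsat T (upd (fun i => y i *+ n.+1) v z).
Proof.
suff [T' hT'] : exists T', forall (G : ogroup) (y : V -> G), nontrivial_og G ->
    tsat T' y <-> exists n z,
      has (all (csat (upd (fun i => y i *+ n.+1) v z))) (tpaths T).
  exists T' => G y ntG; rewrite hT' //; split=> -[n [z h]]; exists n, z;
    by move: h; rewrite tsat_paths.
elim: (tpaths T) => [|P Ps [T1 hT1]].
  by exists (TLeaf false) => G y _; split=> // -[n [z]].
have [P' hP'] := fourier_motzkin v P.
exists (tor (tconj P') T1) => G y ntG; rewrite tsat_or tsat_conj; split=> [/orP[]|].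
- by move/(hP' _ _ ntG) => [n [z h]]; exists n, z; rewrite /= h.
- by move/(hT1 _ _ ntG) => [n [z h]]; exists n, z; rewrite /= h orbT.
- move=> [n [z /= /orP[h|h]]]; apply/orP; [left|right].
    by apply/hP' => //; exists n, z.
  by apply/hT1 => //; exists n, z.
Qed.

Lemma eliminate (vs : seq V) T : exists T', forall (G : ogroup) (y : V -> G),
  nontrivial_og G ->
  tsat T' y <-> exists n (y' : V -> G),
    (forall i, i \notin vs -> y' i = y i *+ n.+1) /\ tsat T y'.
Proof.
elim: vs T => [|v vs IH] T.
  exists T => G y _; split=> [h|[n [y' [e]]]].
    by exists 0%N, y; split=> // i _; rewrite mulr1n.
  by rewrite (_ : y' = fun i => y i *+ n.+1) ?tsat_muln //; apply/funext => i; apply: e.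
have [T1 hT1] := eliminate1 v T; have [T' hT'] := IH T1.
exists T' => G y ntG; rewrite hT' //; split.
  move=> [n [y' [e /(hT1 _ _ ntG) [m [z h]]]]].
  exists (n.+1 * m.+1).-1, (upd (fun i => y' i *+ m.+1) v z); split=> // i.
  rewrite inE negb_or => /andP[/negbTE iv ivs].
  by rewrite /upd iv e // -mulrnA prednK.
(* [IH] only allows the variables of [vs] to change, so [v] first gets its scaled value; [hT1] then
   restores [y' v] with factor 1. *)
move=> [n [y' [e h]]]; exists n, (upd y' v (y v *+ n.+1)); split=> [i ivs|].
  by rewrite /upd; case: eqP => [->//|/eqP iv]; rewrite e // inE negb_or iv.
apply/hT1 => //; exists 0%N, (y' v); congr (is_true (tsat T _)): h.
by apply/funext => i; rewrite /upd; case: eqP => [->|].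
Qed.

(** Once all variables are eliminated, the remaining tree can be read at the zero assignment, where
    every form vanishes and the answer is independent of the group. *)
Lemma tsat_transfer (G H : ogroup) T (y : V -> G) : nontrivial_og G -> nontrivial_og H ->
  tsat T y -> exists z : V -> H, tsat T z.
Proof.
move=> ntG ntH h; have [T' hT'] := eliminate (enum V) T.
have : tsat T' (fun=> 0 : H).
  rewrite (tsat_signs (z := fun=> 0 : G)); last by move=> c _; rewrite !ev_zero !pos0.
  by apply/hT' => //; exists 0%N, y; split=> // i; rewrite mem_enum.
by move/(hT' _ _ ntH) => [n [z [_ hz]]]; exists z.
Qed.

End LinearForms.

(** * Integer approximation *)

Section IntegerGroup.
Import Order.TTheory GRing.Theory Num.Theory.
Local Open Scope ring_scope.

Let int_pos (x : int) := 0 < x.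
Let int_pos0 : int_pos 0 = false. Proof. by []. Qed.
Let int_posD (x y : int) : int_pos x -> int_pos y -> int_pos (x + y).
Proof. exact: addr_gt0. Qed.
Let int_total (x : int) : x <> 0 -> int_pos x \/ int_pos (- x).
Proof. by rewrite /int_pos oppr_gt0; case: (ltrgt0P x); auto. Qed.

Definition int_og : ogroup := Ogroup int_pos0 int_posD int_total.

Lemma nontrivial_int : nontrivial_og int_og. Proof. by exists 1. Qed.

End IntegerGroup.

Section MatrixAction.
Import Order.TTheory GRing.Theory Num.Theory.
Local Open Scope ring_scope.

Definition mxact (G : zmodType) m n (A : 'M[int]_(m, n)) (y : 'I_n -> G) i : G :=
  \sum_j y j *~ A i j.

Lemma mxactM (G : zmodType) m n q (A : 'M_(m, n)) (B : 'M_(n, q)) (y : 'I_q -> G) :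
  mxact (A *m B) y =1 mxact A (mxact B y).
Proof.
move=> i; rewrite /mxact.
under eq_bigr => j _ do rewrite mxE mulrz_sumr.
rewrite exchange_big; apply: eq_bigr => k _; rewrite mulrz_suml.
by apply: eq_bigr => j _; rewrite -mulrzA [A i k * _]mulrC.
Qed.

Lemma mulrz_eq0_og (G : ogroup) (g : G) k : g *~ k = 0 -> g = 0 \/ k = 0.
Proof.
case: k => [[|n]|n]; first by right.
  by move=> e; left; apply: (mulrn_inj (ltn0Sn n)); rewrite mul0rn -e.
rewrite NegzE mulrNz => /eqP; rewrite oppr_eq0 => /eqP e.
by left; apply: (mulrn_inj (ltn0Sn n)); rewrite mul0rn -e.
Qed.

(* In the coordinates given by the Smith normal form, the equations say that
   the coordinates of [y] with a nonzero invariant factor vanish; some remaining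
   coordinate occurs in [C y] with a coefficient prime to p. *)
Lemma integer_kernel (G : ogroup) m n (M : 'M[int]_(m, n)) (C : 'rV[int]_n)
    (y : 'I_n -> G) (p : nat) :
  (forall i, mxact M y i = 0) -> (forall g, mxact C y 0 <> g *+ p) ->
  exists d : 'cV[int]_n, M *m d = 0 /\ ~~ (p %| (C *m d) 0%R 0%R)%Z.
Proof.
have [L uL [R uR [d _ defM]]] := int_Smith_normal_form M.
set D := \matrix_(i, j) _ in defM; pose z := mxact R y; move=> My0 Cy.
have Dz i : mxact D z i = 0.
  have -> : mxact D z i = mxact (invmx L *m M) y i.
    by rewrite defM -mulmxA mulKmx // mxactM.
  by rewrite mxactM /mxact big1 // => j _; rewrite -/(mxact _ _ _) My0 mul0rz.
pose C' := C *m invmx R.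
have eC : mxact C y 0 = \sum_j z j *~ C' 0 j.
  by rewrite -/(mxact C' z 0) -mxactM mulmxKV.
have [j [zj pj]] : exists j, z j <> 0 /\ ~~ (p %| C' 0%R j)%Z.
  apply: contrapT => h; apply: (Cy (\sum_j z j *~ (C' 0%R j %/ p)%Z)).
  rewrite eC -sumrMnl; apply: eq_bigr => j _.
  have [->|zj] := eqVneq (z j) 0; first by rewrite !mul0rz mul0rn.
  have [pj|pj] := boolP (p %| C' 0%R j)%Z; last by case: h; exists j; split=> //; apply/eqP.
  by rewrite pmulrn -mulrzA divzK.
(* Column j of the inverse of [R]: [C] takes the value [C' 0 j] on it, and [M] kills it because
   column j of [D] is zero. *)
exists (invmx R *m delta_mx j 0); split; last first.
  by rewrite mulmxA -/C' -colE mxE.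
rewrite defM mulmxA mulmxK // -mulmxA -colE.
suff -> : col j D = 0 by rewrite mulmx0.
apply/matrixP => i k; rewrite !mxE; case: eqP => //= ij.
have := Dz i; rewrite /mxact (bigD1 j) //= big1 ?addr0 => [|l lj].
  by rewrite mxE ij eqxx mulr1n -ij => /mulrz_eq0_og[/zj//|->].
rewrite mxE ij (_ : (j == l :> nat) = false) ?mulr0z //.
by apply/negbTE; rewrite eq_sym.
Qed.

End MatrixAction.

Section Approximation.
Import Order.TTheory GRing.Theory Num.Theory.
Local Open Scope ring_scope.
Variable V : finType.
Implicit Types (c e f : linform V).

Lemma integer_solution (G : ogroup) (E : seq (linform V)) c (y : V -> G) (p : nat) :
  (forall e, e \in E -> ev e y = 0) -> (forall g, ev c y <> g *+ p) ->
  exists d : V -> int, (forall e, e \in E -> ev e d = 0) /\ ~~ (p %| ev c d)%Z.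
Proof.
move=> Ey cy; pose M := \matrix_(i < size E, j < #|V|) (E`_i (enum_val j)).
pose C : 'rV[int]_#|V| := \row_j c (enum_val j).
have evE (H : zmodType) f (x : V -> H) : ev f x = \sum_(j < #|V|) x (enum_val j) *~ f (enum_val j).
  by rewrite /ev (reindex _ (onW_bij _ (@enum_val_bij V))).
have [||d [Md Cd]] := @integer_kernel G _ _ M C (y \o enum_val) p.
- by move=> i; rewrite -[RHS](Ey E`_i) ?mem_nth // evE; apply: eq_bigr => j _; rewrite mxE.
- move=> g; suff <- : ev c y = mxact C (y \o enum_val) 0 by [].
  by rewrite evE; apply: eq_bigr => j _; rewrite mxE.
exists (fun i => d (enum_rank i) 0); split.
  move=> e /(nthP 0)[i iE <-]; have /matrixP/(_ (Ordinal iE) 0) := Md.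
  rewrite !mxE => <-; rewrite evE; apply: eq_bigr => j _.
  by rewrite enum_valK mxE /= mulrzz mulrC.
congr (~~ (_ %| _)%Z): Cd.
rewrite mxE evE; apply: eq_bigr => j _.
by rewrite enum_valK mxE /= mulrzz mulrC.
Qed.

(** The sign pattern of finitely many forms is a conjunction of constraints, zero being two weak
    inequalities, and so transfers to the integers. *)
Lemma integer_signs (G : ogroup) (F : seq (linform V)) (y : V -> G) : nontrivial_og G ->
  exists z : V -> int, forall f, f \in F ->
    [/\ pos (ev f y) -> 0 < ev f z, pos (- ev f y) -> ev f z < 0 &
        ev f y = 0 -> ev f z = 0].
Proof.
move=> ntG.
pose sg f : seq (constraint V) :=
  if pos (ev f y) then [:: (true, f)] else
  if pos (- ev f y) then [:: (true, - f)] else [:: (false, f); (false, - f)].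
have hy : tsat (tconj (flatten (map sg F))) y.
  rewrite tsat_conj; apply/allP => p /flattenP[s /mapP[f _ ->]].
  rewrite /sg; case: (signP (ev f y)) => [e|pf|pf]; rewrite !inE.
  - by case/orP=> /eqP ->; rewrite /csat /chk /= ?evN /ge0 e ?oppr0 pos0.
  - by move/eqP => ->.
  - by move/eqP => ->; rewrite /csat /chk /= evN.
have [z] := tsat_transfer ntG nontrivial_int hy; rewrite tsat_conj => /allP hz.
exists z => f fF; have {hz} hz p : p \in sg f -> csat z p.
  by move=> ps; apply: hz; apply/flattenP; exists (sg f) => //; apply: map_f.
move: hz; rewrite /sg; case: (signP (ev f y)) => [e|pf|pf] hz; split=> //.
- have h1 := hz (false, f); have h2 := hz (false, - f).
  move: h1 h2; rewrite !inE !eqxx orbT => /(_ isT) h1 /(_ isT) h2 _.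
  by apply: (@ge0_anti int_og) => //; move: h2; rewrite /csat /= evN.
- by move=> _; have := hz (true, f); rewrite inE eqxx; apply.
- by move=> e; move: pf; rewrite e pos0.
- have := hz (true, - f); rewrite inE eqxx => /(_ isT) + _.
  by rewrite /csat /chk /= evN oppr_gt0.
- by move=> e; move: pf; rewrite e oppr0 pos0.
Qed.

(** The point is k z0 + d, with z0 of the right signs and d annihilated by the forms that vanish at
    y but with c(d) prime to p. *)
Lemma approximation_modulo (G : ogroup) (F : seq (linform V)) c (y : V -> G) (p : nat) :
  (0 < p)%N -> (forall g, ev c y <> g *+ p) ->
  exists z : V -> int, (forall f, f \in F -> (0 < ev f z) = pos (ev f y)) /\
    ~~ (p %| ev c z)%Z.
Proof.
move=> p0 cy.
have ntG : nontrivial_og G.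
  have c0 : ev c y <> 0 by move=> e; apply: (cy 0); rewrite mul0rn.
  by case: (pos_total c0) => h; [exists (ev c y)|exists (- ev c y)].
have [z0 hz0] := integer_signs F y ntG.
have [|d [Ed pd]] := @integer_solution G [seq f <- F | ev f y == 0] c y p _ cy.
  by move=> e; rewrite mem_filter => /andP[/eqP].
pose N := \sum_(f <- F) `|ev f d|.
have Nge f : f \in F -> `|ev f d| <= N.
  by move=> fF; rewrite /N (big_rem f) //= lerDl sumr_ge0.
have N0 : 0 <= N by apply: sumr_ge0.
(* A multiple of p, to leave the residue to [d], and larger than all values of [F] at [d], to leave
   the nonzero signs to [z0]. *)
pose k := (p * (`|N|.+1))%N.
have kN : N < k%:Z.
  apply: (@lt_le_trans _ _ (`|N|.+1)%:Z).
    by rewrite -{1}(gez0_abs N0) ltz_nat.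
  by rewrite lez_nat leq_pmull.
exists (fun i => z0 i *+ k + d i).
have evz f : ev f (fun i => z0 i *+ k + d i) = ev f z0 *+ k + ev f d.
  by rewrite ev_add ev_muln.
split=> [f fF|]; last first.
  rewrite evz; have pk : (p %| ev c z0 *+ k)%Z.
    by rewrite -mulr_natr natz dvdz_mull // /k PoszM dvdz_mulr.
  by rewrite (rpredDl _ pk).
have [hp hn h0] := hz0 f fF; have := Nge f fF; rewrite ler_norml => /andP[lo up].
rewrite evz; case: (signP (ev f y)) => [e|/hp h|/hn h].
- by rewrite h0 // mul0rn add0r Ed // mem_filter e eqxx.
- have : k%:Z <= ev f z0 *+ k.
    by rewrite -mulr_natr natz ler_peMl // -gtz0_ge1.
  by move=> h'; apply: lt_le_trans (lerD h' lo); rewrite subr_gt0.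
- apply/negbTE; rewrite -leNgt.
  have h' : ev f z0 *+ k <= - k%:Z.
    by rewrite -mulr_natr natz -mulN1r ler_wpM2r // -ltzD1 addNr.
  by apply: le_trans (lerD h' up) _; rewrite addrC subr_le0 ltW.
Qed.

End Approximation.

(** * Terms as piecewise linear functions *)

Definition solves (A : mvType) V (eqs : seq (term V * term V)) (v : V -> A) :=
  forall i, (i < size eqs)%N ->
    let e := nth (Zero, Zero) eqs i in eval v e.1 = eval v e.2.

Lemma solves_hom (A B : mvType) (f : A -> B) V eqs (v : V -> A) :
  mvmorphism f -> solves eqs v -> solves eqs (f \o v).
Proof. by move=> hf h i /h e /=; rewrite -!(hom_eval hf) e. Qed.

Lemma solves_inj (A B : mvType) (f : A -> B) V eqs (v : V -> A) :
  mvmorphism f -> injective f -> solves eqs (f \o v) -> solves eqs v.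
Proof. by move=> hf inj h i /h /=; rewrite -!(hom_eval hf) => /inj. Qed.

Section TermTrees.
Local Open Scope ring_scope.
Variable V : finType.
Implicit Types (b : V -> bool) (t : term V).

(* The continuation [K] receives the bit and the magnitude of the value of [t];
   the tree branches on the signs that truncated subtractions depend on. *)
Fixpoint tcase b t (K : bool -> linform V -> tree V) : tree V :=
  match t with
  | Var i => K (b i) (fvar i)
  | Zero => K false 0
  | Neg t => tcase b t (fun s c => K (~~ s) c)
  | Add t u => tcase b t (fun s c => tcase b u (fun s' c' =>
      match s, s' with
      | false, false => K false (c + c')
      | true, true => K true 0
      | false, true => TNode (c' - c) (K true (c' - c)) (K true 0)
      | true, false => TNode (c - c') (K true (c - c')) (K true 0)
      end))
  end.

(** The form [c] is that of the branch selected by the signs at [y], and so depends on [v]. *)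
Lemma tcaseP (G : ogroup) (v : V -> gamma G) t K :
  let y i := mag (v i) in
  exists2 c, tsat (tcase (fun i => bit (v i)) t K) y = tsat (K (bit (eval v t)) c) y
           & ev c y = mag (eval v t).
Proof.
set y := fun i => mag (v i) => /=.
elim: t K => [i||t IH|t IHt u IHu] K /=.
- by exists (fvar i); rewrite ?ev_var.
- by exists 0; rewrite ?ev0.
- by have [c e1 e2] := IH (fun s c => K (~~ s) c); exists c.
have [c -> e2] := IHt (fun s c => tcase (fun i => bit (v i)) u (fun s' c' =>
      match s, s' with
      | false, false => K false (c + c')
      | true, true => K true 0
      | false, true => TNode (c' - c) (K true (c' - c)) (K true 0)
      | true, false => TNode (c - c') (K true (c - c')) (K true 0)
      end)).
have [c' -> e2'] := IHu (fun s' c' =>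
      match bit (eval v t), s' with
      | false, false => K false (c + c')
      | true, true => K true 0
      | false, true => TNode (c' - c) (K true (c' - c)) (K true 0)
      | true, false => TNode (c - c') (K true (c - c')) (K true 0)
      end).
rewrite /gadd_mag /tsub.
case: (bit (eval v t)) (bit (eval v u)) => [] [] /=; rewrite ?evB -?e2 -?e2'.
- by exists 0; rewrite ?ev0.
- by case: ifP => h; [exists (c - c'); rewrite ?evB|exists 0; rewrite ?ev0].
- by case: ifP => h; [exists (c' - c); rewrite ?evB|exists 0; rewrite ?ev0].
- by exists (c + c'); rewrite ?evD.
Qed.

Definition eqtree b t u : tree V :=
  tcase b t (fun s c => tcase b u (fun s' c' =>
    if s == s' then TNode (c - c') (TLeaf _ false)
                      (TNode (c' - c) (TLeaf _ false) (TLeaf _ true))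
    else TLeaf _ false)).

Lemma eqtreeP (G : ogroup) (v : V -> gamma G) t u :
  tsat (eqtree (fun i => bit (v i)) t u) (fun i => mag (v i)) <-> eval v t = eval v u.
Proof.
rewrite /eqtree; set K := fun s c => tcase _ u _.
have [c -> e] := tcaseP v t K; rewrite {}/K.
set K := fun s c => if _ then _ else _.
have [c' -> e'] := tcaseP v u K; rewrite {}/K.
case: eqP => be; last by split=> // E; case: be; rewrite E.
rewrite /= !evB e e' -(GRing.opprB (mag (eval v t))).
case: signP => [h|h|h]; split=> // E.
- by apply: gamma_eq => //; apply: GRing.subr0_eq.
- by move: h; rewrite E GRing.subrr pos0.
- by move: h; rewrite E GRing.subrr GRing.oppr0 pos0.
Qed.

Definition soltree b eqs := foldr (fun e T => tand (eqtree b e.1 e.2) T) (TLeaf _ true) eqs.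

Lemma soltreeP (G : ogroup) (v : V -> gamma G) eqs :
  tsat (soltree (fun i => bit (v i)) eqs) (fun i => mag (v i)) <-> solves eqs v.
Proof.
elim: eqs => [|e eqs IH]; first by split.
rewrite /= tsat_and; split=> [/andP[/eqtreeP he /IH h] [|i]|h]; [by []|exact: h|].
apply/andP; split; first by apply/eqtreeP; apply: (h 0%N).
by apply/IH => i; apply: (h i.+1).
Qed.

Definition nonneg_tree : tree V := tconj [seq (false, fvar i) | i <- enum V].

Lemma nonneg_treeP (G : ogroup) (y : V -> G) : tsat nonneg_tree y <-> forall i, ge0 (y i).
Proof.
rewrite tsat_conj; split=> [/allP h i|h].
  by have := h _ (map_f _ (mem_enum V i)); rewrite /csat /chk /= ev_var.
by apply/allP => _ /mapP[i _ ->]; rewrite /csat /chk /= ev_var.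
Qed.

Lemma mag_nonneg (G : ogroup) (v : V -> gamma G) : tsat nonneg_tree (fun i => mag (v i)).
Proof. by apply/nonneg_treeP => i; apply: mag_ge0. Qed.

Lemma gamma_of (G : ogroup) (y : V -> G) b : tsat nonneg_tree y ->
  exists v : V -> gamma G, b = (fun i => bit (v i)) /\ y = (fun i => mag (v i)).
Proof. by move/nonneg_treeP => h; exists (fun i => Gamma (b i) (h i)). Qed.

Lemma transfer_int (G : ogroup) (T : tree V) (y : V -> G) :
  tsat T y -> exists z : V -> int_og, tsat T z.
Proof.
move=> h; have [nt|tr] := EM (nontrivial_og G); first exact: tsat_transfer nt nontrivial_int h.
exists (fun=> 0); rewrite -(tsat_signs (y := y)) // => c _; rewrite ev_zero pos0.
by apply/negP => p; apply: tr; exists (ev c y).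
Qed.

End TermTrees.

(** * A copy of Gamma(Z lex Z) in every non-Boolean algebra of the variety *)

Section ChangEmbedding.
Local Open Scope mv_scope.
Variable A : mvType.
Hypothesis changA : chang A.
Implicit Types x a : A.

Lemma gamma_core (G : ogroup) (x : gamma G) :
  bit (mvmeet x (mvneg x)) = false /\ mag (mvmeet x (mvneg x)) = mag x.
Proof.
rewrite /mvmeet /mvjoin !(bitN, bitD, magN, magD) !negbK.
case: (bit x) => /=; split=> //.
  by rewrite tsubr0 ?mag_ge0.
by rewrite tsubDK ?mag_ge0.
Qed.

Lemma hom_eqP x y : (forall (G : ogroup) (f : A -> gamma G), mvmorphism f -> f x = f y) ->
  x = y.
Proof.
move=> h; apply: contrapT => /(gamma_separation changA)[G [f [hf _]]].
by apply; apply: h.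
Qed.

(* In [gamma G], both (0, r) and (1, -r) have core (0, r). *)
Definition core x := mvmeet x (mvneg x).

(** In every [gamma G] multiples of a core stay in the lower half; their negations lie in the upper
    half, where any two elements add up to 1. *)
Lemma core_orth n m x : mle (nmul n (core x)) (mvneg (nmul m (core x))).
Proof.
apply: hom_eqP => G f hf.
rewrite (hom1 hf) (homD hf) !(homN hf) !(hom_nmul hf) (hom_meet hf) (homN hf).
have [b _] := gamma_core (f x); have bn k : bit (nmul k (mvmeet (f x) (mvneg (f x)))) = false.
  by elim: k => // k IH; rewrite nmulS bitD b IH.
by apply: gamma_eq; rewrite ?bitD ?magD !bitN !bn.
Qed.

Lemma core_eq0 x : core x = 0 -> x + x = x.
Proof.
move=> c0; apply: hom_eqP => G f hf; rewrite (homD hf).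
have [_] := gamma_core (f x); rewrite -(homN hf) -(hom_meet hf) -/(core x) c0 hom0 //= => m0.
apply: gamma_eq; rewrite ?bitD ?orbb // magD -m0.
by case: (bit _); rewrite ?GRing.addr0.
Qed.

Variable a : A.
Hypothesis orth : forall n m, mle (nmul n a) (mvneg (nmul m a)).

Lemma mag_int (u : gamma int_og) : mag u = Posz (absz (mag u)).
Proof.
rewrite gez0_abs //; have := mag_ge0 u; rewrite /ge0 /=.
by rewrite Num.Theory.oppr_gt0 -Order.TotalTheory.leNgt.
Qed.

(** The subalgebra generated by [a]. Under [orth] multiples of [a] are never truncated, so their
    differences are those of natural numbers ([nmul_sub]). *)
Definition emb (u : gamma int_og) : A :=
  let r := nmul (absz (mag u)) a in if bit u then mvneg r else r.

Lemma nmul_sub n m : mvsub (nmul n a) (nmul m a) = nmul (n - m) a.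
Proof.
have [le|lt] := leqP m n.
  rewrite -{1}(subnK le) nmulD addK meet_idPl //; exact: orth.
rewrite (_ : (n - m)%N = 0%N) /=; first by apply/sub_eq0; apply: mle_nmul; apply: ltnW.
by apply/eqP; rewrite subn_eq0 ltnW.
Qed.

Lemma emb_hom : mvmorphism emb.
Proof.
have tsubN n m : absz (@tsub int_og (Posz n) (Posz m)) = (n - m)%N.
  rewrite /tsub /= Num.Theory.subr_gt0 ltz_nat; case: ltnP => h.
    by rewrite subzn ?(ltnW h).
  by apply/esym/eqP; rewrite subn_eq0.
have addN n m : nmul n a + mvneg (nmul m a) = mvneg (nmul (m - n) a).
  by rewrite -nmul_sub /mvsub mvnegK mvaddC.
split=> [|u|u w]; rewrite /emb //=.
  by case: (bit u); rewrite //= mvnegK.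
rewrite /gadd_mag (mag_int u) (mag_int w) /=.
case: (bit u) (bit w) => [] [] /=.
- by rewrite [RHS]orth.
- by rewrite tsubN mvaddC addN.
- by rewrite tsubN addN.
- by rewrite -nmulD.
Qed.

Lemma emb_inj : a <> 0 -> injective emb.
Proof.
move=> a0.
have inj n m : nmul n a = nmul m a -> (n <= m)%N.
  move=> e; rewrite leqNgt; apply/negP => lt; apply: a0; apply: mle_x0.
  have : mvsub (nmul n a) (nmul m a) = 0 by rewrite e mvsubxx.
  rewrite nmul_sub => <-; rewrite -[X in mle X _]mvadd0 -/(nmul 1 a).
  by apply: mle_nmul; rewrite subn_gt0.
have excl n m : nmul n a <> mvneg (nmul m a).
  move=> e; apply: a0; have := orth (n + m) 1; rewrite nmulD e mvnegx_add /= mvadd0.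
  by rewrite /mle mvneg1 mv0add => /(congr1 (@mvneg A)); rewrite mvnegK mvneg1.
move=> u w; rewrite /emb; case eu: (bit u); case ew: (bit w) => e.
- apply: gamma_eq; rewrite ?eu ?ew // (mag_int u) (mag_int w); congr Posz.
  by apply/eqP; rewrite eqn_leq !inj //; apply: mvneg_inj.
- by case: (excl _ _ (esym e)).
- by case: (excl _ _ e).
- apply: gamma_eq; rewrite ?eu ?ew // (mag_int u) (mag_int w); congr Posz.
  by apply/eqP; rewrite eqn_leq !inj.
Qed.

End ChangEmbedding.

Definition nonboolean (A : mvType) := exists x : A, mvadd x x <> x.

Lemma nonboolean_core (A : mvType) : chang A -> nonboolean A ->
  exists x : A, core x <> mv0.
Proof. by move=> cA [x nx]; exists x => /(core_eq0 cA). Qed.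

(** A counterexample in [A] survives in some [gamma G], transfers to the integers with the same
    bits, and is carried into [A0] by the embedding generated by a nonzero core. *)
Lemma quasi_identity_transfer (A0 A : mvType) (V : finType) eqs (s t : term V) :
  chang A0 -> nonboolean A0 -> chang A ->
  (forall v : V -> A0, solves eqs v -> eval v s = eval v t) ->
  forall v : V -> A, solves eqs v -> eval v s = eval v t.
Proof.
move=> c0 nb0 cA h v sv; apply: contrapT => /(gamma_separation cA)[G [f [hf _ nst]]].
have [x x0] := nonboolean_core c0 nb0.
pose w := f \o v; have sw : solves eqs w by apply: solves_hom.
(* The bits are frozen; [nonneg_tree] ensures that the integers found are magnitudes. *)
pose b i := bit (w i); pose T := tand (soltree b eqs) (tand (tneg (eqtree b s t)) (nonneg_tree V)).
have [|z] := @transfer_int V G T (fun i => mag (w i)).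
  rewrite !tsat_and tsat_neg mag_nonneg andbT; apply/andP; split; first exact/soltreeP.
  by apply/negP => /eqtreeP; rewrite -!(hom_eval hf).
rewrite !tsat_and tsat_neg => /and3P[h1 h2 /gamma_of - /(_ b)[u [eb ez]]].
rewrite eb ez in h1 h2; move: h1 => /soltreeP su; case/negP: h2; apply/eqtreeP.
pose orth n m := core_orth c0 n m x.
apply: (emb_inj orth x0); rewrite !(hom_eval (emb_hom orth)).
by apply: h; apply: solves_hom => //; apply: emb_hom.
Qed.

(** * Systems of equations *)

Fixpoint tmap V W (f : V -> W) (t : term V) : term W :=
  match t with
  | Var i => Var (f i) | Zero => Zero | Neg t => Neg (tmap f t)
  | Add t u => Add (tmap f t) (tmap f u)
  end.

Lemma eval_tmap (A : mvSigType) V W (f : V -> W) (v : W -> A) t :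
  eval v (tmap f t) = eval (v \o f) t.
Proof. by elim: t => //= [t ->|t -> u ->]. Qed.

Section SolvesLists.
Variables (A : mvType) (V : Type).
Implicit Type v : V -> A.

Lemma solves_cons e eqs v :
  solves (e :: eqs) v <-> eval v e.1 = eval v e.2 /\ solves eqs v.
Proof.
split=> [h|[h k] [|i]]; [|by []|exact: (k i)].
by split=> [|i]; [apply: (h 0%N)|apply: (h i.+1)].
Qed.

Lemma solves_cat eqs eqs' v : solves (eqs ++ eqs') v <-> solves eqs v /\ solves eqs' v.
Proof.
elim: eqs => [|e eqs IH]; first by split=> [|[]].
by rewrite cat_cons !solves_cons IH; tauto.
Qed.

End SolvesLists.

Lemma solves_map (A : mvType) V W (f : W -> V) eqs (v : V -> A) :
  solves [seq (tmap f e.1, tmap f e.2) | e <- eqs] v <-> solves eqs (v \o f).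
Proof.
elim: eqs => [|e l IH]; first by split=> _ [].
by rewrite map_cons !solves_cons IH /= !eval_tmap.
Qed.

Section Systems.
Local Open Scope mv_scope.
Variables (X Z : finType) (eqs : seq (term (X + Z) * term (X + Z))).
Implicit Types A B : mvType.

Definition glue T (x : X -> T) (z : Z -> T) (i : X + Z) : T :=
  match i with inl i => x i | inr j => z j end.

Lemma comp_glue T U (f : T -> U) (x : X -> T) (z : Z -> T) :
  f \o glue x z = glue (f \o x) (f \o z).
Proof. by apply/funext => -[]. Qed.

Lemma glue_eta T (v : X + Z -> T) : v = glue (v \o inl) (v \o inr).
Proof. by apply/funext => -[]. Qed.

Definition has_solution A := forall x : X -> A, exists z, solves eqs (glue x z).
Definition unique_solution A := forall (x : X -> A) z z',
  solves eqs (glue x z) -> solves eqs (glue x z') -> forall j, z j = z' j.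

(** Uniqueness is a family of quasi-identities, one per unknown, over two copies of the unknowns;
    [r1] and [r2] rename into these copies and share the parameters. *)
Lemma unique_solution_transfer A0 A : chang A0 -> nonboolean A0 -> chang A ->
  unique_solution A0 -> unique_solution A.
Proof.
move=> c0 nb0 cA un0 x z z' sz sz' j.
pose r1 (i : X + Z) : X + (Z + Z) := match i with inl i => inl i | inr j => inr (inl j) end.
pose r2 (i : X + Z) : X + (Z + Z) := match i with inl i => inl i | inr j => inr (inr j) end.
pose E := [seq (tmap r1 e.1, tmap r1 e.2) | e <- eqs] ++
          [seq (tmap r2 e.1, tmap r2 e.2) | e <- eqs].
have := @quasi_identity_transfer A0 A _ E (Var (inr (inl j))) (Var (inr (inr j))) c0 nb0 cA.
move=> h; apply: (h _ (fun i => match i with inl i => x i | inr (inl j) => z j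
  | inr (inr j) => z' j end)).
  move=> v /solves_cat[/solves_map s1 /solves_map s2] /=.
  apply: (un0 (v \o inl) (fun j => v (inr (inl j))) (fun j => v (inr (inr j)))).
    by congr (solves eqs _): s1; apply/funext => -[].
  by congr (solves eqs _): s2; apply/funext => -[].
apply/solves_cat; split; apply/solves_map.
  by congr (solves eqs _): sz; apply/funext => -[].
by congr (solves eqs _): sz'; apply/funext => -[].
Qed.

(* Solutions modulo R and modulo S agree modulo the composite of R and S by
   uniqueness, so permutability of congruences yields a common one. *)
Lemma patch_existence A (x : X -> A) : chang A ->
  (forall B (f : A -> B), mvmorphism f -> (forall b, exists a, f a = b) ->
    unique_solution B) ->
  (forall (G : ogroup) (f : A -> gamma G), mvmorphism f ->
    (forall b, exists a, f a = b) -> exists z, solves eqs (glue (f \o x) z)) ->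
  exists z, solves eqs (glue x z).
Proof.
move=> cA un chain; apply: contrapT => none.
pose L (z : Z -> A) i := let e := nth (Zero, Zero) eqs i in
  (eval (glue x z) e.1, eval (glue x z) e.2).
have solE (R : A -> A -> Prop) (cR : congruence R) z :
    solved_mod (size eqs) L R z <-> solves eqs (glue (cls cR \o x) (cls cR \o z)).
  rewrite -comp_glue; split=> h i /h /=.
    by move=> /(clsP cR) e; rewrite -!(hom_eval (cls_hom cR)).
  by rewrite -!(hom_eval (cls_hom cR)) => /(clsP cR).
have [||R [cR [nR tot]]] := @unsolvable_chain A (Z -> A) (size eqs) L.
- by case=> z h; apply: none; exists z.
- move=> R S cR cS [z hz] [w hw].
  have cT := comp_rel_congr cR cS.
  have sub1 a b : R a b -> comp_rel R S a b by exists b => //; case: cS.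
  have sub2 a b : S a b -> comp_rel R S a b by exists a => //; case: cR.
  have /choice[u hu] : forall j, exists a, R (z j) a /\ S a (w j).
    move=> j; suff /(clsP cT)[a Ra Sa] : cls cT (z j) = cls cT (w j) by exists a.
    apply: (un _ _ (cls_hom cT) (@cls_surj _ _ cT) (cls cT \o x)
      (cls cT \o z) (cls cT \o w)); apply/solE => i ik.
      exact/sub1/hz.
    exact/sub2/hw.
  exists u => i ik; split.
    suff : solved_mod (size eqs) L R u by apply.
    apply/(solE _ cR); congr (solves eqs (glue _ _)): (iffLR (solE _ cR z) hz).
    by apply/funext => j /=; apply/clsP; case: (hu j).
  suff : solved_mod (size eqs) L S u by apply.
  apply/(solE _ cS); congr (solves eqs (glue _ _)): (iffLR (solE _ cS w) hw).
  by apply/funext => j /=; apply/esym/clsP; case: (hu j).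
have cB : chang (quot cR).
  have [h _ _] := chang_variety.
  by apply: h (cls_hom cR) _ cA; apply: cls_surj.
have n01 : 0 <> mv1 (quot cR).
  move=> e; apply: nR; exists (fun=> 0); apply/(solE _ cR) => i ik /=.
  exact: mv_trivial e _ _.
pose g := chain_map cB tot; have hg : mvmorphism g by apply: chain_map_hom.
have hf := hom_comp (cls_hom cR) hg.
have surj u : exists a, (g \o cls cR) a = u.
  have [b <-] := chain_map_surj n01 u.
  by have [a <-] := cls_surj b; exists a.
have [z sz] := chain _ _ hf surj; have [w hw] := choice (fun j => surj (z j)).
apply: nR; exists w; apply/(solE _ cR); apply: (solves_inj hg).
  exact: chain_map_inj.
rewrite comp_glue; congr (solves eqs (glue _ _)): sz.
by apply/funext => j; rewrite -hw.
Qed.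

End Systems.

(** * The operations t_k as injective endomorphisms *)

Section Scaling.
Local Open Scope mv_scope.
Variable A : mvType.
Hypothesis changA : chang A.

Lemma mvt_hom n : mvmorphism (@mvt A n.+1).
Proof.
split=> [|x|x y]; apply: (hom_eqP changA) => G f hf.
- by rewrite (hom_t hf) gamma_t (hom0 hf) (hom0 (gscale_hom G n)).
- by rewrite [LHS](hom_t hf) [RHS](homN hf) (hom_t hf) (homN hf) !gamma_t (homN (gscale_hom G n)).
- by rewrite [LHS](hom_t hf) [RHS](homD hf) !(hom_t hf) (homD hf) !gamma_t
    (homD (gscale_hom G n)).
Qed.
Lemma mvt_inj n : injective (@mvt A n.+1).
Proof.
move=> x y e; apply: (hom_eqP changA) => G f hf; apply: (@gscale_inj _ n).
by rewrite -!gamma_t -!(hom_t hf) e.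
Qed.
Lemma mvt_comp n m (x : A) : mvt n.+1 (mvt m.+1 x) = mvt (n.+1 * m.+1) x.
Proof.
apply: (hom_eqP changA) => G f hf; rewrite !(hom_t hf).
rewrite -[(n.+1 * m.+1)%N]prednK // !gamma_t; apply: gamma_eq => //=.
by rewrite -GRing.mulrnA mulnC.
Qed.

Lemma core_range n (x y : A) : mvt n.+1 y = core x -> exists z, mvt n.+1 z = x.
Proof.
(* On each chain [b] is 1 or 0 according to the bit of x. The witness is the symmetric difference of
   y and b: the negation of y where that bit is set and y elsewhere, which restores the half that
   [core] forgets. *)
move=> e; pose b := mvmuln 2 (mvexp x 2).
exists (mvjoin (mvmeet y (mvneg b)) (mvmeet b (mvneg y))).
apply: (hom_eqP changA) => G f hf; rewrite (hom_t hf) (hom_join hf) !(hom_meet hf).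
rewrite !(homN hf) (hom_muln hf) (hom_exp hf); set u := f y.
have eu : gscale n u = core (f x).
  by rewrite -gamma_t -(hom_t hf) e (hom_meet hf) (homN hf).
have [bc mc] := gamma_core (f x).
have bu : bit u = false by rewrite -bc -[mvmeet _ _]eu.
have mu : (mag u *+ n.+1)%R = mag (f x) by rewrite -mc -[mvmeet _ _]eu.
have -> : mvmuln 2 (mvexp (f x) 2) = if bit (f x) then mv1 _ else 0.
  apply: gamma_eq; rewrite /mvmuln /mvexp /= ?orbb.
    by case: (bit _).
  by rewrite /gadd_mag /= /gadd_mag /=; case: (bit (f x)); rewrite /= ?GRing.addr0.
rewrite gamma_t; case bx: (bit (f x)).
  rewrite mvneg1 (meet_idPr (mle0 _)) (meet_idPr (mle1 _)) (join_idPr (mle0 _)).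
  by apply: gamma_eq; rewrite /= ?bu ?bx.
rewrite (meet_idPl (mle1 _)) (meet_idPl (mle0 _)) joinC (join_idPr (mle0 _)).
by apply: gamma_eq; rewrite /= ?bu ?bx.
Qed.

(** Bezout gives 1 + lk = v(p + 1); scaling va - ly by p + 1 then yields v(p + 1)a - lka = a. *)
Lemma mvt_core_multiple p k (a y : A) (orth : forall n m, mle (nmul n a) (mvneg (nmul m a))) :
  coprime p.+1 k -> mvt p.+1 y = nmul k a -> exists z, mvt p.+1 z = a.
Proof.
move=> cop e; have [l _ /dvdnP[v ev]] := @Bezoutr k p.+1 isT.
move: ev; rewrite gcdnC (eqP cop) => ev.
exists (mvsub (nmul v a) (nmul l y)).
rewrite (hom_sub (mvt_hom p)) !(hom_nmul (mvt_hom p)) e.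
have -> : mvt p.+1 a = nmul p.+1 a.
  have g1 : @ge0 int_og 1%R by [].
  have e1 : emb a (Gamma false g1) = a by rewrite /emb /= mvadd0.
  rewrite -{1}e1 -(hom_t (emb_hom orth)) gamma_t.
  rewrite -[LHS]/(nmul (absz (1 *+ p.+1)%R) a).
  by rewrite natz.
have nmulM n m : nmul n (nmul m a) = nmul (n * m) a.
  by elim: n => //= n ->; rewrite -nmulD mulSn.
by rewrite !nmulM nmul_sub // -ev addnK /= mvadd0.
Qed.

End Scaling.

(** Factors through the two-element algebra, whence the independence of [G] and [H]. *)
Definition gzero (G H : ogroup) (u : gamma G) : gamma H := Gamma (bit u) (ge0_0 H).

Lemma gzero_hom (G H : ogroup) : mvmorphism (@gzero G H).
Proof.
split=> [|u|u w]; apply: gamma_eq => //=.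
by rewrite /gadd_mag /=; case: (bit u) (bit w) => [] []; rewrite /= ?tsubrr ?GRing.addr0.
Qed.

(** * Solvability on chains up to a scaling factor *)

Section Existence.
Local Open Scope mv_scope.
Variables (X Z : finType) (eqs : seq (term (X + Z) * term (X + Z))).
Local Notation V := (X + Z)%type.

Lemma eliminate_cases (I : eqType) (l : seq I) (T : I -> tree V) :
  exists U : tree V, forall (G : ogroup) (y : V -> G), nontrivial_og G ->
  tsat U y <-> exists c, [/\ c \in l & exists n (y' : V -> G),
    (forall i, y' (inl i) = (y (inl i) *+ n.+1)%R) /\ tsat (T c) y'].
Proof.
elim: l => [|c l [U hU]].
  by exists (TLeaf _ false) => G y _; split=> // -[c []].
have [U1 hU1] := eliminate [seq inr j | j <- enum Z] (T c).
exists (tor U1 U) => G y nt; rewrite tsat_or; split=> [/orP[]|].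
- move=> /(hU1 _ _ nt)[n [y' [e h]]]; exists c; split; first exact: mem_head.
  exists n, y'; split=> // i; apply: e.
  by apply/negP => /mapP[].
- by move=> /(hU _ _ nt)[d [dl h]]; exists d; split=> //; rewrite inE dl orbT.
- move=> [d [+ [n [y' [e h]]]]]; rewrite inE => /predU1P[ed|dl]; apply/orP; [left|right].
    apply/(hU1 _ _ nt); exists n, y'; rewrite -ed; split=> // -[i _|j]; first exact: e.
    by move/negP; case; apply: map_f; rewrite mem_enum.
  by apply/(hU _ _ nt); exists d; split=> //; exists n, y'.
Qed.

Variables (A0 : mvType) (chang0 : chang A0) (nonbool0 : nonboolean A0).
Hypothesis sol0 : has_solution eqs A0.

Lemma mag_emb (a : A0) (G : ogroup) (f : A0 -> gamma G) (u : gamma int_og) :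
  mvmorphism f -> bit (f a) = false ->
  bit (f (emb a u)) = bit u /\ mag (f (emb a u)) = (mag (f a) *~ mag u)%R.
Proof.
move=> hf ba; have bn n : bit (nmul n (f a)) = false /\ mag (nmul n (f a)) = (mag (f a) *+ n)%R.
  elim: n => //= n [IHb IHm]; rewrite /gadd_mag ba IHb /=; split=> //.
  by rewrite IHm GRing.mulrS.
have [b m] := bn (absz (mag u)).
have -> : (mag (f a) *~ mag u = mag (f a) *+ absz (mag u))%R by rewrite {1}mag_int -pmulrn.
rewrite /emb; case: (bit u).
  by rewrite (homN hf) bitN magN !(hom_nmul hf) b m.
by rewrite !(hom_nmul hf) b m.
Qed.

(** [U] expresses solvability up to scale for the bits of [x]. If it failed at [x], it would fail at
    nonnegative integers. These embed into [A0] along a core a; a solution in [A0], projected to a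
    chain where a is nonzero, makes [U] true at the same integers times the magnitude of a, hence
    with the same signs. *)
Lemma solution_up_to_scale (G : ogroup) (x : X -> gamma G) : nontrivial_og G ->
  exists n z, solves eqs (glue (gscale n \o x) z).
Proof.
move=> ntG; pose b (c : {ffun Z -> bool}) := glue (fun i => bit (x i)) c.
pose T c := tand (soltree (b c) eqs) (nonneg_tree V).
have [U hU] := eliminate_cases (enum {ffun Z -> bool}) T.
have inl_only (H : ogroup) (y y' : V -> H) : nontrivial_og H ->
    (forall i, y (inl i) = y' (inl i)) -> tsat U y -> tsat U y'.
  move=> nt e /(hU _ _ nt)[c [cl [n [y1 [e1 h1]]]]]; apply/(hU _ _ nt).
  by exists c; split=> //; exists n, y1; split=> // i; rewrite e1 e.
pose y : V -> G := glue (fun i => mag (x i)) (fun=> 0%R).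
have yU : tsat U y.
  apply: contrapT => /negP nU.
  have [|z] := @transfer_int V G (tand (tneg U) (nonneg_tree V)) y.
    rewrite tsat_and tsat_neg nU; apply/nonneg_treeP => -[i|j]; first exact: mag_ge0.
    exact: ge0_0.
  rewrite tsat_and tsat_neg => /andP[/negP nUz /nonneg_treeP z0].
  apply: nUz; pose x' i := Gamma (bit (x i)) (z0 (inl i)).
  have [w w0] := nonboolean_core chang0 nonbool0; set a := core w in w0.
  have [s sols] := sol0 (emb a \o x').
  have [H [f [hf _ fa]]] := gamma_separation chang0 w0.
  have [ba _] := gamma_core (f w); rewrite -(homN hf) -(hom_meet hf) -/a in ba.
  have pa : pos (mag (f a)).
    case: (signP (mag (f a))) => // [m0|]; last by rewrite (negbTE (mag_ge0 _)).
    by case: fa; rewrite (hom0 hf); apply: gamma_eq.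
  have ntH : nontrivial_og H by exists (mag (f a)).
  pose v := f \o glue (emb a \o x') s.
  have vU : tsat U (fun i => mag (v i)).
    apply/(hU _ _ ntH); exists [ffun j => bit (f (s j))]; split; first by rewrite mem_enum.
    exists 0%N, (fun i => mag (v i)); split; first by move=> i; rewrite GRing.mulr1n.
    rewrite tsat_and mag_nonneg andbT.
    have -> : b [ffun j => bit (f (s j))] = fun i => bit (v i).
      apply/funext => -[i|j] /=; last by rewrite ffunE.
      by rewrite /v /=; case: (mag_emb (x' i) hf ba).
    by apply/soltreeP; apply: solves_hom.
  have vU' : tsat U (fun i => (mag (f a) *~ z i)%R).
    apply: inl_only vU => // i; rewrite /v /=.
    by case: (mag_emb (x' i) hf ba).
  rewrite -(tsat_signs (y := fun i => (mag (f a) *~ z i)%R)) // => c _.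
  rewrite ev_comb; case: (ev c z) => [[|n]|n] /=.
  - by rewrite mulr0z pos0.
  - by rewrite -pmulrn pos_mulrn // pa.
  - by rewrite NegzE mulrNz -pmulrn posN // pos_mulrn.
have [c [_ [n [y' [e h]]]]] := iffLR (hU _ _ ntG) yU.
move: h; rewrite tsat_and => /andP[h /gamma_of - /(_ (b c))[v [eb ey]]].
rewrite eb ey in h; move: h => /soltreeP sv.
exists n, (v \o inr); rewrite (glue_eta v) in sv.
congr (solves eqs (glue _ _)): sv; apply/funext => i; apply: gamma_eq => /=.
  by rewrite -(congr1 (fun f => f (inl i)) eb).
by rewrite -(congr1 (fun f => f (inl i)) ey) e.
Qed.

Lemma solution_trivial_group (G : ogroup) (x : X -> gamma G) : ~ nontrivial_og G ->
  exists z, solves eqs (glue x z).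
Proof.
move=> tr; pose p := @gzero int_og G; pose q := @gzero G int_og.
have [n [z sz]] := solution_up_to_scale (q \o x) nontrivial_int.
exists (p \o z); have := solves_hom (gzero_hom int_og G) sz.
rewrite comp_glue; congr (solves eqs (glue _ _)); apply/funext => i.
apply: gamma_eq => //=; case: (signP (mag (x i))) => // [h|].
  by case: tr; exists (mag (x i)).
by rewrite (negbTE (mag_ge0 _)).
Qed.

End Existence.

(** * Removing the scaling factor *)

Section Denominators.
Local Open Scope mv_scope.
Variables (X Z : finType) (eqs : seq (term (X + Z) * term (X + Z))).
Local Notation V := (X + Z)%type.

Definition mvdivisible (A : mvType) p := forall x : A, exists y, mvt p y = x.

(* A solution over [gamma int_og] with denominator p would be carried, by the
   embedding generated by an element a that is not p-divisible, to a solution whose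
   uniqueness forces a to be p-divisible. *)
Lemma solution_divisible (Ap : mvType) p (G : ogroup) (x : X -> gamma G) z n :
  prime p -> chang Ap -> has_solution eqs Ap -> unique_solution eqs Ap ->
  ~ mvdivisible Ap p -> p %| n.+1 -> solves eqs (glue (gscale n \o x) z) ->
  forall j, exists g, mag (z j) = (g *+ p)%R.
Proof.
move=> pp cA sol un nd pn sz j; apply: contrapT => nz.
pose v := glue x z; pose y i := mag (v i).
pose b i := bit (v i).
(* The parameters solved for are n + 1 times [x]. Moving this factor into the coefficients and
   approximating [x] itself keeps the approximated parameters divisible by n + 1. *)
pose sub (T : zmodType) (u : V -> T) : V -> T := glue (fun i => (u (inl i) *+ n.+1)%R) (u \o inr).
pose subf (f : linform V) : linform V :=
  [ffun i => match i with inl _ => (f i *+ n.+1)%R | inr _ => f i end].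
have subE (T : zmodType) (u : V -> T) f : ev (subf f) u = ev f (sub T u).
  apply: eq_bigr => -[i|k] _; rewrite ffunE //=.
  by rewrite -GRing.mulr_natl natz mulrzA -pmulrn.
have [|w [hw pw]] := @approximation_modulo V G
    ([seq subf f | f <- tforms (soltree b eqs)] ++ tforms (nonneg_tree V))
    (fvar (inr j)) y p (prime_gt0 pp).
  by move=> g; rewrite ev_var => e; apply: nz; exists g.
have w0 : tsat (nonneg_tree V) (w : V -> int_og).
  rewrite (tsat_signs (z := y)) ?mag_nonneg // => c cT.
  by rewrite -hw ?mem_cat ?cT ?orbT.
have [u [eb eu]] := gamma_of b w0.
have su : solves eqs (glue (gscale n \o (u \o inl)) (u \o inr)).
  have eb' : b = fun i => bit (glue (gscale n \o (u \o inl)) (u \o inr) i).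
    by rewrite eb; apply/funext => -[].
  apply/soltreeP; rewrite -eb'.
  have -> : (fun i => mag (glue (gscale n \o (u \o inl)) (u \o inr) i)) = sub int w.
    by apply/funext => -[i|k] /=; rewrite eu.
  rewrite (@tsat_signs _ int_og G _ _ (sub G y)).
    have -> : sub G y = fun i => mag (glue (gscale n \o x) z i).
      by apply/funext => -[].
    have -> : b = fun i => bit (glue (gscale n \o x) z i) by apply/funext => -[].
    exact/soltreeP.
  move=> c cT; rewrite -[in LHS]subE -[in RHS]subE -hw //.
  by rewrite mem_cat map_f.
move/existsNP: nd => [t nt]; pose a := core t.
pose orth k m := core_orth cA k m t.
have [s ss] := sol (emb a \o (u \o inl)).
(* Two solutions in [Ap] for the same parameters: the scaled solution for the unscaled parameters,
   and the image of the integer solution. *)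
have e : mvt n.+1 (s j) = emb a (u (inr j)).
  apply: (un (emb a \o gscale n \o (u \o inl)) (mvt n.+1 \o s) (emb a \o (u \o inr))).
    have := solves_hom (mvt_hom cA n) ss; rewrite comp_glue.
    congr (solves eqs (glue _ _)); apply/funext => i /=.
    by rewrite -(hom_t (emb_hom orth)) gamma_t.
  by have := solves_hom (emb_hom orth) su; rewrite comp_glue.
have [m en] : exists m, n.+1 = (p * m.+1)%N.
  case/dvdnP: pn => -[|m] // ->; by exists m; rewrite mulnC.
have p1 : p = p.-1.+1 by rewrite prednK // prime_gt0.
rewrite en p1 -(mvt_comp cA) in e.
have [q eq] : exists q, mvt p.-1.+1 q = nmul (absz (w (inr j))) a.
  have -> : w (inr j) = mag (u (inr j)) by rewrite eu.
  move: e; rewrite /emb; case: (bit _) => e; last by exists (mvt m.+1 (s j)).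
  by exists (mvneg (mvt m.+1 (s j))); rewrite (homN (mvt_hom cA _)) e mvnegK.
have [|r er] := mvt_core_multiple cA orth _ eq.
  rewrite -p1 prime_coprime //; move: pw; rewrite ev_var.
  by rewrite dvdzE.
by have [q' eq'] := core_range cA er; apply: nt; exists q'; rewrite p1.
Qed.

(** Descent on the factor n + 1: a prime p dividing it divides all magnitudes of the solution, and
    cancels because scaling by p is an injective endomorphism. *)
Lemma has_solution_gamma (G : ogroup) :
  (exists A0, [/\ chang A0, nonboolean A0 & has_solution eqs A0]) ->
  (forall p, prime p -> (forall g : G, exists h, (h *+ p)%R = g) \/
    exists Ap, [/\ chang Ap, has_solution eqs Ap, unique_solution eqs Ap &
      ~ mvdivisible Ap p]) ->
  has_solution eqs (gamma G).
Proof.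
move=> [A0 [c0 nb0 sol0]] div x.
have [nt|tr] := EM (nontrivial_og G); last exact: solution_trivial_group c0 nb0 sol0 _ _ tr.
have [n [z sz]] := solution_up_to_scale c0 nb0 sol0 x nt.
elim/ltn_ind: n z sz => -[|n] IH z sz.
  exists z; congr (solves eqs (glue _ _)): sz.
  by apply/funext => i; apply: gamma_eq => //=; rewrite GRing.mulr1n.
pose p := pdiv n.+2; have pp : prime p by apply: pdiv_prime.
have pn : p %| n.+2 by apply: pdiv_dvd.
have [m en] : exists m, n.+2 = (p * m.+1)%N.
  case/dvdnP: pn => -[|m] // ->; by exists m; rewrite mulnC.
have p1 : p = p.-1.+1 by rewrite prednK // prime_gt0.
have /choice[w hw] : forall j, exists w, gscale p.-1 w = z j.
  move=> j; have [g eg] : exists g, mag (z j) = (g *+ p)%R.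
    case: (div p pp) => [dG|[Ap [cA sA uA nd]]].
      by have [h <-] := dG (mag (z j)); exists h.
    exact: solution_divisible pp cA sA uA nd pn sz j.
  have g0 : ge0 g by rewrite -(ge0_mulrn _ (prime_gt0 pp)) -eg mag_ge0.
  by exists (Gamma (bit (z j)) g0); apply: gamma_eq; rewrite //= -p1.
apply: (IH m _ w).
  by rewrite -ltnS en ltn_Pmull // prime_gt1.
apply: (solves_inj (gscale_hom G p.-1) (@gscale_inj G p.-1)).
rewrite comp_glue; congr (solves eqs (glue _ _)): sz.
  apply/funext => i; apply: gamma_eq => //=.
  by rewrite en -GRing.mulrnA -p1 mulnC.
by apply/funext => j; rewrite -hw.
Qed.

End Denominators.

(** * Satisfaction of EFD-sentences *)

Section Sentences.
Local Open Scope mv_scope.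

Lemma sat_EFD (A : mvType) n m eqs :
  sat A (@EFD n m eqs) <-> has_solution eqs A /\ unique_solution eqs A.
Proof.
have asgn (x : n.-tuple A) (z : m.+1.-tuple A) : assign x z = glue (tnth x) (tnth z).
  by apply/funext => -[].
have tup k (f : 'I_k -> A) : tnth (mktuple f) = f.
  by apply/funext => i; rewrite tnth_mktuple.
split=> [h|[sol un] x].
  split=> [x|x z z' sz sz' j].
    have [z [hz _]] := h (mktuple x); exists (tnth z).
    by rewrite -(tup _ x) -asgn.
  have [t [_ ht]] := h (mktuple x).
  have E w : solves eqs (glue x w) -> t = mktuple w.
    by move=> sw; apply: ht; rewrite asgn !tup.
  by rewrite -(tup _ z) -(tup _ z') -(E z) // -(E z').
have [z sz] := sol (tnth x); exists (mktuple z); split; first by rewrite asgn tup.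
move=> w; rewrite asgn => sw; apply: eq_from_tnth => j; rewrite tnth_mktuple.
exact: un sz sw j.
Qed.

Lemma eval_t (A : mvSigType) V (v : V -> A) k (t : term V) :
  eval v (mvt k t) = mvt k (eval v t).
Proof.
have em n s : eval v (mvmuln n s) = mvmuln n (eval v s).
  case: n => // n; rewrite /mvmuln !iteropS.
  by elim: n => //= n ->.
have ee n s : eval v (mvexp s n) = mvexp (eval v s) n.
  case: n => // n; rewrite /mvexp !iteropS.
  by elim: n => //= n ->.
rewrite /mvt /mvjoin /mvmeet /mvjoin /=.
by rewrite !em !ee.
Qed.

(** Uniqueness comes for free from the injectivity of t_p. *)
Lemma sat_eps (A : mvType) p : chang A -> (0 < p)%N ->
  sat A (efd_eps p) <-> mvdivisible A p.
Proof.
move=> cA; case: p => // p _; rewrite /efd_eps sat_EFD.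
set eqs := [:: _].
have sE x z : solves eqs (@glue 'I_1 'I_1 A x z) <-> mvt p.+1 (z ord0) = x ord0.
  split=> [/solves_cons[+ _]|e]; first by rewrite [LHS]eval_t.
  by apply/solves_cons; split=> //; rewrite [LHS]eval_t.
split=> [[sol _] x|div].
  by have [z /sE] := sol (fun=> x); exists (z ord0).
split=> [x|x z z' /sE e /sE e' j].
  by have [z hz] := div (x ord0); exists (fun=> z); apply/sE.
by rewrite ord1; apply: (mvt_inj cA (n := p)); rewrite e e'.
Qed.

Definition boolean (A : mvType) := forall x : A, x + x = x.

Lemma sat_trivial_axiom (A : mvType) : sat A trivial_axiom <-> forall x y : A, x = y.
Proof.
split=> [h x y|h x]; last exact: h.
by have := h [tuple x; y]; rewrite /= !(tnth_nth x).
Qed.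

Lemma sat_boolean_axiom (A : mvType) : sat A boolean_axiom <-> boolean A.
Proof.
split=> [h x|h x]; last exact: h.
by have := h [tuple x]; rewrite /= !(tnth_nth x).
Qed.

Lemma sat_one_element (A : mvType) phi : efd_sentence phi ->
  (forall x y : A, x = y) -> sat A phi.
Proof.
move=> [n [m [eqs ->]]] triv; apply/sat_EFD; split=> [x|x z z' _ _ j]; last exact: triv.
by exists (fun=> 0) => i _; apply: triv.
Qed.

Lemma boolean_nonboolean (A : mvType) : ~ nonboolean A -> boolean A.
Proof. by move=> h x; apply: contrapT => nx; apply: h; exists x. Qed.

Lemma boolean_mag (A : mvType) (G : ogroup) (f : A -> gamma G) x : mvmorphism f ->
  boolean A -> mag (f x) = 0%R.
Proof.
move=> hf bA; have /(congr1 (@mag G)) : f x + f x = f x by rewrite -(homD hf) bA.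
rewrite magD; case: (bit _) => // e.
by apply: (GRing.addrI (mag (f x))); rewrite GRing.addr0.
Qed.

Lemma boolean_divisible (A : mvType) p : chang A -> boolean A -> (0 < p)%N ->
  mvdivisible A p.
Proof.
move=> cA bA; case: p => // p _ x; exists x; apply: (hom_eqP cA) => G f hf.
rewrite (hom_t hf) gamma_t; apply: gamma_eq => //=.
by rewrite (boolean_mag x hf bA) GRing.mul0rn.
Qed.

Lemma divisible_group (A : mvType) (G : ogroup) (f : A -> gamma G) p :
  mvmorphism f -> (forall u, exists a, f a = u) -> (0 < p)%N ->
  mvdivisible A p -> forall g : G, exists h, (h *+ p)%R = g.
Proof.
move=> hf surj; case: p => // p _ div g.
wlog g0 : g / ge0 g => [W|].
  case: (ge0_total g 0%R); rewrite ?GRing.subr0 ?GRing.sub0r => /W // [h e].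
  by exists (- h)%R; rewrite GRing.mulNrn e GRing.opprK.
have [x fx] := surj (Gamma false g0); have [y ey] := div x.
exists (mag (f y)); rewrite -[RHS]/(mag (Gamma false g0)) -fx -ey.
by rewrite (hom_t hf) gamma_t.
Qed.

Lemma gamma_divisible (G : ogroup) p : (0 < p)%N ->
  mvdivisible (gamma G) p <-> forall g : G, exists h, (h *+ p)%R = g.
Proof.
move=> p0; split=> [div|].
  by apply: (@divisible_group _ _ id p _ _ p0 div) => // u; exists u.
case: p p0 => // p p0 h u; have [g e] := h (mag u).
have g0 : ge0 g by rewrite -(ge0_mulrn _ p0) e mag_ge0.
by exists (Gamma (bit u) g0); rewrite gamma_t; apply: gamma_eq.
Qed.

(** For each prime p, either all models of [phi] satisfy eps_p, and then [A] and the groups of its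
    chain quotients are p-divisible, or a model that violates eps_p serves to cancel p. *)
Lemma sat_nonboolean phi (A0 A : mvType) : efd_sentence phi ->
  VP A0 -> nonboolean A0 -> sat A0 phi -> VP A ->
  (forall p, prime p -> (forall B, VP B -> sat B phi -> sat B (efd_eps p)) ->
     sat A (efd_eps p)) ->
  sat A phi.
Proof.
move=> [n [m [eqs ->]]] v0 nb0 /sat_EFD[sol0 un0] vA div.
have [c0 cA] := (VP_chang v0, VP_chang vA).
have un B : chang B -> unique_solution eqs B.
  by move=> cB; apply: unique_solution_transfer un0.
apply/sat_EFD; split; last exact: un.
move=> x; apply: (patch_existence cA) => [B f hf surj|G f hf surj].
  by apply: un; apply: VP_chang; exact: VP_hom hf surj vA.
apply: has_solution_gamma; first by exists A0.
move=> p pp; have p0 := prime_gt0 pp.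
have [all|] := EM (forall B, VP B -> sat B (@EFD n m eqs) -> sat B (efd_eps p)).
  by left; apply: (divisible_group hf surj p0); apply/(sat_eps cA p0)/div.
move/existsNP=> [B] /not_implyP[vB] /not_implyP[/sat_EFD[solB unB] nB].
have cB := VP_chang vB; right; exists B; split=> //.
by move/(sat_eps cB p0).
Qed.

Definition bit_map (G : ogroup) (A : mvType) (u : gamma G) : A :=
  if bit u then mv1 A else 0.

Lemma bit_map_hom (G : ogroup) (A : mvType) : mvmorphism (@bit_map G A).
Proof.
split=> [|u|u w]; rewrite /bit_map //=.
  by case: (bit u); rewrite /= ?mvneg1.
by case: (bit u) (bit w) => [] []; rewrite /= ?mv1add ?mv0add.
Qed.

(** Only bits matter in a Boolean algebra. Sending bits to 0 and 1 of [A0] transports uniqueness;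
    for existence the system is solved in [A0], and the solution is projected to a chain and
    stripped of magnitudes. *)
Lemma sat_boolean phi (A0 A : mvType) : efd_sentence phi ->
  VP A0 -> (0 : A0) <> mv1 A0 -> sat A0 phi -> VP A -> boolean A -> sat A phi.
Proof.
move=> [n [m [eqs ->]]] v0 n01 /sat_EFD[sol0 un0] vA bA.
have c0 := VP_chang v0.
have un B : VP B -> boolean B -> unique_solution eqs B.
  move=> vB bB x z z' sz sz' j; apply: contrapT.
  move=> /(gamma_separation (VP_chang vB))[G [f [hf _ nz]]]; apply: nz.
  have hg := hom_comp hf (@bit_map_hom G A0).
  have s1 := solves_hom hg sz; have s2 := solves_hom hg sz'.
  rewrite !comp_glue in s1 s2; have := un0 _ _ _ s1 s2 j => /= e.
  apply: gamma_eq; last by rewrite !(boolean_mag _ hf bB).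
  by move: e; rewrite /bit_map; case: (bit _) (bit _) => [] [] // /esym.
apply/sat_EFD; split; last exact: un.
move=> x; apply: (patch_existence (VP_chang vA)) => [B f hf surj|G f hf surj].
  apply: un; first exact: VP_hom hf surj vA.
  by move=> b; have [a <-] := surj b; rewrite -(homD hf) bA.
have [H [g [hg _ _]]] := gamma_separation c0 n01.
have [z sz] := sol0 (@bit_map G A0 \o f \o x).
have hr := hom_comp hg (gzero_hom H G).
exists (@gzero H G \o g \o z).
have := solves_hom hr sz; rewrite comp_glue.
congr (solves eqs (glue _ _)); apply/funext => i; apply: gamma_eq => /=.
  rewrite /bit_map; case: ifP => _; [by rewrite (hom1 hg)|by rewrite (hom0 hg)].
by rewrite (boolean_mag _ hf bA).
Qed.

End Sentences.

(** * Classification *)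

Section Localization.
Import Order.TTheory GRing.Theory Num.Theory.
Local Open Scope ring_scope.

(* The localization of Z at the prime p; for [p = 1] every rational qualifies,
   with [n = 0]. *)
Definition local_pred (p : nat) : {pred rat} :=
  fun q => `[< exists n (a : int), coprime p n /\ q *+ n = a%:~R >].

Lemma local_zmod p : zmod_closed (local_pred p).
Proof.
split=> [|q r /asboolP[n [a [cn en]]] /asboolP[m [b [cm em]]]]; apply/asboolP.
  by exists 1%N, 0; rewrite coprimen1.
exists (n * m)%N, (a *+ m - b *+ n); rewrite coprimeMr cn cm; split=> //.
by rewrite mulrnBl mulrnA en mulnC mulrnA em rmorphB !rmorphMn.
Qed.

Section Group.
Variable p : nat.

HB.instance Definition _ := GRing.isZmodClosed.Build rat (local_pred p) (local_zmod p).

Record local := Local { local_val : rat; local_valP : local_pred p local_val }.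

HB.instance Definition _ := [isSub for local_val].
HB.instance Definition _ := [Choice of local by <:].
HB.instance Definition _ := [SubChoice_isSubZmodule of local by <:].

Let local_pos (x : local) := 0 < val x.
Let local_pos0 : local_pos 0 = false.
Proof. by rewrite /local_pos raddf0. Qed.
Let local_posD (x y : local) : local_pos x -> local_pos y -> local_pos (x + y).
Proof. by rewrite /local_pos raddfD; apply: addr_gt0. Qed.
Let local_total (x : local) : x <> 0 -> local_pos x \/ local_pos (- x).
Proof.
rewrite /local_pos raddfN /= oppr_gt0 => x0; case: (ltrgt0P (val x)); auto.
by move=> v0; case: x0; apply: val_inj; rewrite raddf0.
Qed.

Definition local_og : ogroup := Ogroup local_pos0 local_posD local_total.
End Group.

Lemma local_nontrivial p : exists g : local_og p, g <> 0.
Proof.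
have l1 : local_pred p 1 by apply/asboolP; exists 1%N, 1; rewrite coprimen1.
by exists (Local l1) => /(congr1 val).
Qed.

Lemma local_divisible p q : (0 < q)%N -> coprime p q ->
  forall g : local_og p, exists h, h *+ q = g.
Proof.
move=> q0 cpq g; have q0' : (q%:R : rat) != 0 by rewrite pnatr_eq0 -lt0n.
have lq : local_pred p (val g / q%:R).
  have /asboolP[n [a [cn e]]] := local_valP g.
  apply/asboolP; exists (q * n)%N, a; rewrite coprimeMr cpq cn; split=> //.
  by rewrite mulrnA -[X in X *+ n]mulr_natr divfK.
exists (Local lq : local_og p); apply: val_inj.
by rewrite raddfMn /= -[LHS]mulr_natr divfK.
Qed.

Lemma local_not_divisible p : prime p ->
  ~ forall g : local_og p, exists h, h *+ p = g.
Proof.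
move=> pp div; have l1 : local_pred p 1 by apply/asboolP; exists 1%N, 1; rewrite coprimen1.
have [h /(congr1 val)] := div (Local l1); rewrite raddfMn /= => e.
have /asboolP[n [a [cn en]]] := local_valP h.
have : (n%:Z)%:~R = (a *+ p)%:~R :> rat.
  by rewrite rmorphMn /= -en -mulrnA mulnC mulrnA e.
move=> /intr_inj /(congr1 absz); rewrite -mulr_natr natz abszM !absz_nat => nE.
by move: cn; rewrite prime_coprime // nE dvdn_mull.
Qed.

End Localization.

Section Classes.
Local Open Scope mv_scope.

Lemma gamma_nonboolean (G : ogroup) : (exists g : G, g <> 0%R) -> nonboolean (gamma G).
Proof.
move=> [g g0]; have [h h0 ph] : exists2 h : G, h <> 0%R & ge0 h.
  case: (ge0_total g 0%R); rewrite ?GRing.subr0 ?GRing.sub0r => k; first by exists g.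
  by exists (- g)%R => // e; apply: g0; rewrite -[g]GRing.opprK e GRing.oppr0.
exists (Gamma false ph) => /(congr1 (@mag G)); rewrite magD /= => e.
by apply: h0; apply: (GRing.addrI h); rewrite GRing.addr0.
Qed.

Lemma local_eps p q : prime q -> coprime p q -> sat (gamma (local_og p)) (efd_eps q).
Proof.
move=> pq cpq; have q0 := prime_gt0 pq.
apply/(sat_eps (VP_chang (VP_gamma _)) q0)/(gamma_divisible _ q0).
exact: local_divisible.
Qed.

Lemma local_not_eps p : prime p -> ~ sat (gamma (local_og p)) (efd_eps p).
Proof.
move=> pp; have p0 := prime_gt0 pp.
move=> /(sat_eps (VP_chang (VP_gamma _)) p0)/(gamma_divisible _ p0).
exact: local_not_divisible.
Qed.

Lemma boolean_eps A p : VP A -> boolean A -> prime p -> sat A (efd_eps p).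
Proof.
move=> vA bA pp; have p0 := prime_gt0 pp.
by apply/(sat_eps (VP_chang vA) p0)/boolean_divisible => //; apply: VP_chang.
Qed.

Lemma two_element : exists A : mvType, [/\ VP A, boolean A & (0 : A) <> mv1 A].
Proof.
pose R (u w : gamma int_og) := bit u = bit w.
have cR : congruence R.
  split=> [x//|x y//|x y z|x y e|x y x' y' e e']; rewrite /R.
  - by move=> ->.
  - by rewrite !bitN e.
  - by rewrite !bitD e e'.
exists (quot cR); split.
- exact: VP_hom (cls_hom cR) (@cls_surj _ _ cR) (VP_gamma _).
- move=> q; have [u <-] := cls_surj q; rewrite -(homD (cls_hom cR)).
  by apply/(clsP cR); rewrite /R bitD orbb.
- by rewrite -(hom1 (cls_hom cR)) => /(clsP cR).
Qed.

Definition all_models (Sigma : set sentence) (P : mvType -> Prop) :=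
  forall A, VP A -> model Sigma A -> P A.

Lemma model_set1 phi A : model [set phi] A <-> sat A phi.
Proof. by split=> [|h _ ->//]; apply. Qed.

Lemma model_boolean (Sigma : set sentence) (A0 A : mvType) : Sigma `<=` efd_sentence ->
  VP A0 -> model Sigma A0 -> (0 : A0) <> mv1 A0 -> VP A -> boolean A -> model Sigma A.
Proof.
move=> efd v0 m0 n01 vA bA phi Sphi.
exact: sat_boolean (efd _ Sphi) v0 n01 (m0 _ Sphi) vA bA.
Qed.

Lemma classification (Sigma : set sentence) : Sigma `<=` efd_sentence ->
  [\/ equivalent_over VP Sigma [set trivial_axiom],
      equivalent_over VP Sigma [set boolean_axiom] |
      exists2 S : set nat, S `<=` [set p | prime p]
                         & equivalent_over VP Sigma (Sigma_of S)].
Proof.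
move=> efd.
have [[A0 [v0 m0 n01]]|triv] :=
  EM (exists A : mvType, [/\ VP A, model Sigma A & (0 : A) <> mv1 A]); last first.
  constructor 1 => A vA; rewrite model_set1 sat_trivial_axiom; split=> [mA|t phi Sphi].
    by apply: mv_trivial; apply: contrapT => n01; apply: triv; exists A.
  by apply: sat_one_element t; apply: efd.
have [[A1 [v1 m1 nb1]]|allb] :=
  EM (exists A : mvType, [/\ VP A, model Sigma A & nonboolean A]); last first.
  constructor 2 => A vA; rewrite model_set1 sat_boolean_axiom; split=> [mA|bA].
    by apply: boolean_nonboolean => nb; apply: allb; exists A.
  exact: model_boolean v0 m0 n01 vA bA.
constructor 3; exists [set p | prime p /\ all_models Sigma (fun A => sat A (efd_eps p))].
  by move=> p [].
move=> A vA; split=> [mA _ [p [pp all] <-]|mS phi Sphi]; first exact: all.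
apply: sat_nonboolean (efd _ Sphi) v1 nb1 (m1 _ Sphi) vA _ => p pp allB.
(* A prime forced by [phi] alone is forced by [Sigma], whose models are models of [phi]. *)
apply: mS; exists p => //; split=> // B vB mB.
by apply: allB => //; apply: mB.
Qed.

Lemma model_Sigma_of_subset (S S' : set nat) :
  S `<=` [set p | prime p] -> S' `<=` [set p | prime p] ->
  (forall A, VP A -> model (Sigma_of S) A -> model (Sigma_of S') A) <-> S' `<=` S.
Proof.
move=> pS pS'; split=> [h p S'p|SS A _ mA _ [p S'p <-]]; last first.
  by apply: mA; exists p => //; apply: SS.
apply: contrapT => nSp; apply: (local_not_eps (pS' _ S'p)).
apply: (h _ (VP_gamma _)); last by exists p.
move=> _ [q Sq <-]; have pq := pS _ Sq; apply: local_eps => //.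
rewrite prime_coprime ?dvdn_prime2 //; try exact: pS'.
by apply/eqP => e; apply: nSp; rewrite e.
Qed.

Lemma boolean_Sigma_of A S : VP A -> boolean A -> S `<=` [set p | prime p] ->
  model (Sigma_of S) A.
Proof. by move=> vA bA pS _ [p Sp <-]; apply: boolean_eps => //; apply: pS. Qed.

(** [local_og 1] is the additive group of the rationals, divisible by every prime. *)
Lemma nonboolean_Sigma_of S : S `<=` [set p | prime p] ->
  exists A, [/\ VP A, nonboolean A & model (Sigma_of S) A].
Proof.
move=> pS; exists (gamma (local_og 1)); split; first exact: VP_gamma.
  by apply: gamma_nonboolean; apply: local_nontrivial.
by move=> _ [p Sp <-]; apply: local_eps; [apply: pS|rewrite coprime1n].
Qed.

Lemma prime_enumeration : exists e : nat -> nat,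
  [/\ injective e, forall n, prime (e n) & forall p, prime p -> exists n, e n = p].
Proof.
have inf : infinite_set [set p | prime p].
  move=> /finite_seqP[s es]; have [p mp pp] := prime_above (\max_(q <- s) q).
  have ps : p \in s by have : [set p | prime p] p := pp; rewrite es.
  by move: mp; rewrite ltnNge (@leq_bigmax_seq _ s xpredT id p ps isT).
have /card_esym/card_set_bijP[e [he inj surj]] := eq_card_nat (countableP _) inf.
exists e; split=> [m n|n|p pp].
- by move/inj; apply; rewrite inE.
- exact: he.
- by have [n _ en] := surj p pp; exists n.
Qed.

End Classes.

(** * The lattice of AE-subclasses *)

Section Lattice.
Local Open Scope mv_scope.
Variable e : nat -> nat.
Hypotheses (e_inj : injective e) (e_prime : forall n, prime (e n))
  (e_surj : forall p, prime p -> exists n, e n = p).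

(* The lattice of AE-subclasses is dual to that of sets of primes, whence the
   complement. *)
Definition index_primes (Y : set nat) : set nat := [set e n | n in ~` Y].

Lemma index_primes_prime Y : index_primes Y `<=` [set p | prime p].
Proof. by move=> _ [n _ <-]; apply: e_prime. Qed.

Lemma index_primes_subset Y Y' : index_primes Y' `<=` index_primes Y <-> Y `<=` Y'.
Proof.
split=> [h n Yn|h _ [n nY' <-]]; last by exists n => // /h.
apply: contrapT => nY'; have [|m nYm /e_inj em] := h (e n); first by exists n.
by apply: nYm; rewrite em.
Qed.

Lemma index_primes_surj S : S `<=` [set p | prime p] -> exists Y, S = index_primes Y.
Proof.
move=> pS; exists [set n | ~ S (e n)]; apply/seteqP; split=> [p Sp|_ [n nY <-]].
  by have [n en] := e_surj (pS _ Sp); exists n => // -[]; rewrite en.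
exact: contrapT.
Qed.

Definition class_of_index (i : bool + set nat) : mvclass := fun A => VP A /\
  match i with
  | inl false => forall x y : A, x = y
  | inl true => boolean A
  | inr Y => model (Sigma_of (index_primes Y)) A
  end.

(** The two identities have to be rewritten as EFD-sentences: 2x = x becomes the unique existence of
    z with z = x and 2x = x, and x = y the unique existence of z subject to no equation. *)
Lemma AE_class_of_index i : AE_subclass (class_of_index i).
Proof.
case: i => [[]|Y].
- pose eqs : seq (term ('I_1 + 'I_1) * term ('I_1 + 'I_1)) :=
    [:: (Var (inr ord0), Var (inl ord0)); (Add (Var (inl ord0)) (Var (inl ord0)), Var (inl ord0))].
  have sE (A : mvType) x z : solves eqs (@glue 'I_1 'I_1 A x z) <->
      z ord0 = x ord0 /\ x ord0 + x ord0 = x ord0.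
    rewrite /eqs !solves_cons /=; split=> [[? [? _]]|[? ?]] //; do 2 split=> //.
  exists [set @EFD 1 0 eqs]; first by move=> _ ->; exists 1%N, 0%N, eqs.
  apply/funext => A; apply/propext; rewrite /class_of_index model_set1 sat_EFD.
  split=> -[vA]; last first.
    by move=> [sol _]; split=> // x; have [z /sE[]] := sol (fun=> x).
  move=> bA; split=> //; split=> [x|x z z' /sE[ez _] /sE[ez' _] j].
    by exists x; apply/sE.
  by rewrite ord1 ez ez'.
- exists [set @EFD 0 0 [::]]; first by move=> _ ->; exists 0%N, 0%N, [::].
  apply/funext => A; apply/propext; rewrite /class_of_index model_set1.
  split=> -[vA]; first by move=> t; split=> //; apply: sat_one_element t; exists 0%N, 0%N, [::].
  move=> /sat_EFD[_ un]; split=> // x y.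
  by apply: (un (fun i => x) (fun=> x) (fun=> y) _ _ ord0) => i.
- exists (Sigma_of (index_primes Y)) => // _ [p _ <-].
  by eexists _, _, _.
Qed.

Definition AE_of_index i : AE_class := exist _ _ (AE_class_of_index i).

Definition index_le := ordsum_le two_le (fun X Y : set nat => X `<=` Y).

Lemma index_leP i j : AE_le (AE_of_index i) (AE_of_index j) <-> index_le i j.
Proof.
have triv_bool (A : mvType) : (forall x y : A, x = y) -> boolean A by move=> h x; apply: h.
case: i j => [a|Y] [b|Y'] /=.
- case: a b => [] [].
  + by split=> // _ A.
  + split=> // h; have [A [vA bA n01]] := two_element.
    by have [_ t] := h A (conj vA bA); case: n01; apply: t.
  + by split=> // _ A [vA t]; split=> //; apply: triv_bool.
  + by split=> // _ A.
- split=> // _ A [vA hA]; split=> //.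
  apply: boolean_Sigma_of => //; last exact: index_primes_prime.
  by case: a hA => // /triv_bool.
- split=> // h; have [A [vA nbA mA]] := nonboolean_Sigma_of (@index_primes_prime Y).
  have [_ hA] := h A (conj vA mA); case: nbA => x; apply.
  by case: b hA {h} => // /triv_bool.
- rewrite -index_primes_subset -model_Sigma_of_subset; try exact: index_primes_prime.
  split=> h A; first by move=> vA mA; have [] := h A (conj vA mA).
  by move=> [vA mA]; split=> //; apply: h.
Qed.

Lemma AE_of_index_surj C : exists i, AE_of_index i = C.
Proof.
case: C => C hC; have [Sigma efd eC] := hC.
suff [i ei] : exists i, class_of_index i = C by exists i; apply: eq_exist.
have ext i : (forall A, VP A -> model Sigma A <->
    match i with
    | inl false => forall x y : A, x = y
    | inl true => boolean A
    | inr Y => model (Sigma_of (index_primes Y)) A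
    end) -> class_of_index i = C.
  move=> h; rewrite eC; apply/funext => A; apply/propext.
  by split=> -[vA k]; split=> //; apply/(h A vA).
have [eq|eq|[S pS eq]] := classification efd.
- by exists (inl false); apply: ext => A vA; rewrite eq // model_set1 sat_trivial_axiom.
- by exists (inl true); apply: ext => A vA; rewrite eq // model_set1 sat_boolean_axiom.
- have [Y eY] := index_primes_surj pS.
  by exists (inr Y); apply: ext => A vA; rewrite -eY; apply: eq.
Qed.

Lemma index_le_anti i j : index_le i j -> index_le j i -> i = j.
Proof.
case: i j => [a|Y] [b|Y'] //=; first by case: a b => [] [].
by move=> h k; congr inr; apply/seteqP.
Qed.

Lemma AE_lattice : order_isomorphic AE_le index_le.
Proof.
have [f fK] := choice AE_of_index_surj; exists f.
  (* The choice makes [f] a section of [AE_of_index]; injectivity of the latter comes from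
     antisymmetry of [index_le]. *)
  exists AE_of_index => // i; apply: index_le_anti; apply/index_leP; rewrite fK;
    by move=> A.
by move=> C D; rewrite -index_leP !fK.
Qed.

End Lattice.

Theorem theorem5p15 :
  [/\ forall Sigma : set sentence, Sigma `<=` efd_sentence ->
        exactly_one_of_three
          (equivalent_over VP Sigma [set trivial_axiom])
          (equivalent_over VP Sigma [set boolean_axiom])
          (exists2 S : set nat, S `<=` [set p | prime p]
                              & equivalent_over VP Sigma (Sigma_of S)),
      forall S S' : set nat,
        S `<=` [set p | prime p] -> S' `<=` [set p | prime p] ->
        equivalent_over VP (Sigma_of S) (Sigma_of S') -> S = S'
    & order_isomorphic AE_le
        (ordsum_le two_le (fun X Y : set nat => X `<=` Y))].
Proof.
split.
- move=> Sigma efd; have [A2 [v2 b2 n2]] := two_element; split.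
  + by case: (classification efd); auto.
  + move=> [h k]; apply: n2.
    have /(h _ v2) /model_set1 /sat_trivial_axiom t : model Sigma A2.
      by apply/(k _ v2)/model_set1/sat_boolean_axiom.
    exact: t.
  + move=> [h [S pS k]]; apply: n2.
    have /(h _ v2) /model_set1 /sat_trivial_axiom t : model Sigma A2.
      by apply/(k _ v2)/boolean_Sigma_of.
    exact: t.
  + move=> [h [S pS k]]; have [A [vA [x nx] mA]] := nonboolean_Sigma_of pS.
    apply: nx; have /(h _ vA) /model_set1 /sat_boolean_axiom b : model Sigma A.
      exact/(k _ vA).
    exact: b.
- move=> S S' pS pS' eq; apply/seteqP; split.
    by apply/(model_Sigma_of_subset pS' pS) => A vA /(eq A vA).
  by apply/(model_Sigma_of_subset pS pS') => A vA /(eq A vA).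
- have [e [e_inj e_prime e_surj]] := prime_enumeration.
  exact: AE_lattice e_inj e_prime e_surj.
Qed.
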